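(* Let $T$ be an irreducible triangulation of a closed surface other than the sphere $S_0$, let $w_1w_2w_3$ be a nonseparating 3-cycle of $T$, and let $T'$ be the pre-irreducible triangulation obtained from $T$ by the cut/cap operation along $w_1w_2w_3$ (with boundary vertices $u'_1,u'_2,u'_3,v'_1,v'_2,v'_3$ as described in the context). Let $T''$ be a triangulation obtained from $T'$ by contracting zero or more interior edges. Then: (1) every edge of $T''$ is a frame edge, or is not contractible, or lies on a path of length at most 3 connecting $u'_i$ and $v'_i$ for some $i\in\{1,2,3\}$; (2) every vertex of $T''$ is a frame vertex, or lies on a noncontractible edge, or lies both on a path of length at most 3 connecting $u'_i$ and $v'_i$ and on a path of length at most 3 connecting $u'_j$ and $v'_j$ for some $1 \le i < j \le 3$.
   Context: A triangulation of a closed surface is a simple graph embedded in the surface such that each face is a triangle and any two faces share at most one edge. For an edge $ac$ with incident faces $abc$ and $acd$, the contraction of $ac$ deletes $ac$, identifies $a$ and $c$, and removes one of each pair of resulting multiple edges ($ab$/$cb$ and $ad$/$cd$). An edge is contractible if its contraction yields a triangulation of the same surface (for triangulations other than $K_4$ on the sphere, equivalently if it lies on exactly two 3-cycles, namely the two facial ones). A triangulation is irreducible if it has no contractible edges. A 3-cycle embedded as a closed curve $C$ in surface $S$ is nonseparating if $S-C$ is connected; it is one-sided if a neighbourhood of $C$ is a Möbius band, and two-sided otherwise. Cut/cap operation: if $w_1w_2w_3$ is two-sided, cut the surface along it, obtaining two boundary 3-cycles $u'_1u'_2u'_3$ and $v'_1v'_2v'_3$, where $u'_i$ and $v'_i$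 come from $w_i$; cap each hole with a new face $u'_1u'_2u'_3$, resp. $v'_1v'_2v'_3$. If $w_1w_2w_3$ is one-sided, cut along it, obtaining a boundary 6-cycle $u'_1u'_2u'_3v'_1v'_2v'_3$ (again $u'_i,v'_i$ come from $w_i$); cap the hole with a new vertex $t'$ and the six faces $t'u'_1u'_2$, $t'u'_2u'_3$, $t'u'_3v'_1$, $t'v'_1v'_2$, $t'v'_2v'_3$, $t'v'_3u'_1$. The result $T'$ is called a pre-irreducible triangulation. The frame is the subgraph consisting of the vertices and edges of the two added faces (two-sided case) or of the six added faces (one-sided case); its vertices and edges are frame vertices and frame edges. Non-frame vertices are interior vertices; an interior edge is an edge both of whose endpoints are interior vertices. Contracting interior edges leaves the frame (and the labels $u'_i,v'_i$) unchanged. *)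

(* Defs.v *)
From mathcomp Require Import all_boot all_order all_algebra.

Set Implicit Arguments.
Unset Strict Implicit.
Unset Printing Implicit Defensive.

(* A triangulation is given by its set of faces, each face being the set of its
   three vertices.  In an embedded simple graph with triangular faces, any two
   of which share at most one edge, a face is determined by its vertices, so
   the faces determine the graph and the surface up to homeomorphism.  The
   finType V is only a supply of names: the vertices are the elements of
   [cover T]. *)

Section Triangulations.
Variable V : finType.
Implicit Types (T : {set {set V}}) (a c x y z : V) (f g : {set V}).

Definition vertices T : {set V} := cover T.

Definition edges T : {set {set V}} :=
  [set e : {set V} | (#|e| == 2) && [exists f in T, e \subset f]].

Definition adj T : rel V := fun x y => [set x; y] \in edges T.

(* The last two conditions on a vertex x (its edges lie on two faces, its link
   is connected) say that the link of x is a cycle. *)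
Record triangulation T : Prop := Triangulation {
  tri_nonempty : T != set0;
  tri_face : forall f, f \in T -> #|f| = 3;
  tri_edge : forall e, e \in edges T -> #|[set f in T | e \subset f]| = 2;
  tri_link : forall x y z, adj T x y -> adj T x z ->
    connect (fun y' z' => [set x; y'; z'] \in T) y z;
  tri_connected : forall x y, x \in vertices T -> y \in vertices T ->
    connect (adj T) x y
}.

Definition euler_char T : int :=
  (#|vertices T|%:Z - #|edges T|%:Z + #|T|%:Z)%R.

(* [o x y z] says that the face xyz is oriented in the cyclic order x, y, z;
   two faces sharing an edge must induce opposite directions on it. *)
Definition orientation T (o : V -> V -> V -> bool) : Prop :=
  forall x y z, [set x; y; z] \in T ->
    [/\ o y z x = o x y z,
        o x z y = ~~ o x y z &
        forall t, t != z -> [set x; y; t] \in T -> o x y t = ~~ o x y z].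

Definition orientable T : Prop := exists o, orientation T o.

Definition is_sphere T : Prop :=
  orientable T /\ euler_char T = (2%:Z)%R.

Definition merge a c : V -> V := fun x => if x == c then a else x.

(* The two faces at ac degenerate and disappear; equality of sets identifies
   the resulting multiple edges.  If more edges than the two pairs at the faces
   of ac get identified, the result is not a triangulation. *)
Definition contract T a c : {set {set V}} :=
  [set merge a c @: (f : {set V}) | f in T & ~~ ([set a; c] \subset f)].

End Triangulations.

(* Homeomorphism of closed connected surfaces, expressed through their
   classification by Euler characteristic and orientability. *)
Definition same_surface (V V' : finType)
    (T : {set {set V}}) (T' : {set {set V'}}) : Prop :=
  euler_char T = euler_char T' /\ (orientable T <-> orientable T').

Section Contraction.
Variable V : finType.
Implicit Types (T : {set {set V}}) (a c x y : V).

Definition contractible T a c : Prop :=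
  triangulation (contract T a c) /\ same_surface T (contract T a c).

Definition irreducible T : Prop :=
  forall a c, adj T a c -> ~ contractible T a c.

(* [contracts_avoiding Fr T T2]: T2 results from T by successively contracting
   zero or more contractible edges with no endpoint in Fr. *)
Inductive contracts_avoiding (Fr : {set V}) T : {set {set V}} -> Prop :=
| contracts_refl : contracts_avoiding Fr T T
| contracts_step T1 a c :
    contracts_avoiding Fr T T1 ->
    adj T1 a c -> a \notin Fr -> c \notin Fr -> contractible T1 a c ->
    contracts_avoiding Fr T (contract T1 a c).

(* [x :: p] is a path of length at most 3 from x to y. *)
Definition short_path T x y (p : seq V) : bool :=
  [&& path (adj T) x p, uniq (x :: p), last x p == y & size p <= 3].

Definition edge_on_path a c (s : seq V) : bool :=
  infix [:: a; c] s || infix [:: c; a] s.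

End Contraction.

Section ThreeCycles.
Variables (V : finType) (T : {set {set V}}) (w : 'I_3 -> V).

(* Indices in 'I_3 are added modulo 3. *)
Definition three_cycle : Prop := forall i, adj T (w i) (w (i + 1)%R).

Definition cycle_edges : {set {set V}} :=
  [set [set w i; w (i + 1)%R] | i : 'I_3].

(* S - C is connected: all faces can be joined by crossing edges not in C. *)
Definition nonseparating : Prop :=
  forall f g, f \in T -> g \in T ->
    connect (fun f' g' => [&& f' \in T, g' \in T &
               f' :&: g' \in edges T :\: cycle_edges]) f g.

Definition meets_cycle (f : {set V}) : bool := [exists i, w i \in f].

(* Let N be a narrow band around C.  As long as C is not the boundary of a
   face, each face meeting C contains one piece of N - C, and the pieces in two
   faces are glued along a common edge that meets C without belonging to it. *)
Definition band_adj : rel {set V} := fun f g =>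
  [&& f \in T, g \in T, f :&: g \in edges T :\: cycle_edges &
      meets_cycle (f :&: g)].

(* N is a Moebius band, rather than an annulus, iff N - C is connected. *)
Definition one_sided : bool :=
  [forall f in T, forall g in T,
     meets_cycle f ==> meets_cycle g ==> connect band_adj f g].

(* For a face f at w_i, [side i f] tells whether, after cutting, f is incident
   to u'_i (true) or to v'_i (false).  The sides are exchanged exactly when an
   edge of C is crossed, and are kept along the edges of C, except that in the
   one-sided case the boundary 6-cycle u'_1 u'_2 u'_3 v'_1 v'_2 v'_3 makes them
   switch along w_3 w_1. *)
Definition cut_sides (side : 'I_3 -> {set V} -> bool) : Prop :=
  (forall i f g, f \in T -> g \in T -> f :&: g \in edges T ->
     w i \in f :&: g ->
     side i f = side i g (+) (f :&: g \in cycle_edges)) /\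
  (forall i f, f \in T -> w i \in f -> w (i + 1)%R \in f ->
     side (i + 1)%R f = side i f (+) (one_sided && (i == 2%R))).

End ThreeCycles.

(* Vertices after cutting and capping: those off C, six boundary vertices, and
   the vertex t', used only in the one-sided case. *)
Definition cut_vertex (V : finType) : finType := option (V + 'I_3 * bool)%type.

Section CutCap.
Variables (V : finType) (T : {set {set V}}) (w : 'I_3 -> V).
Variable side : 'I_3 -> {set V} -> bool.
Local Notation V' := (cut_vertex V).

Definition old (x : V) : V' := Some (inl x).
Definition bnd (i : 'I_3) (b : bool) : V' := Some (inr (i, b)).
Definition u' (i : 'I_3) : V' := bnd i true.
Definition v' (i : 'I_3) : V' := bnd i false.
Definition t' : V' := None.

Definition cut_corner (f : {set V}) (x : V) : V' :=
  if [pick i | w i == x] is Some i then bnd i (side i f) else old x.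

Definition cut_face (f : {set V}) : {set V'} := cut_corner f @: f.

Definition cap_faces : {set {set V'}} :=
  if one_sided T w then
    [set f in [:: [set t'; u' 0%R; u' 1%R]; [set t'; u' 1%R; u' 2%R];
                  [set t'; u' 2%R; v' 0%R]; [set t'; v' 0%R; v' 1%R];
                  [set t'; v' 1%R; v' 2%R]; [set t'; v' 2%R; u' 0%R]]]
  else [set [set u' 0%R; u' 1%R; u' 2%R]; [set v' 0%R; v' 1%R; v' 2%R]].

Definition pre_irreducible : {set {set V'}} := cut_face @: T :|: cap_faces.

Definition frame_vertices : {set V'} := vertices cap_faces.
Definition frame_edges : {set {set V'}} := edges cap_faces.

End CutCap.

(* Main.v *)
Require Import Defs.
From mathcomp Require Import all_boot all_order all_algebra.
From mathcomp Require Import zify.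

(* Call an edge flat if every 3-cycle through it bounds a face.  A contractible
   edge is flat, and in a triangulation other than a tetrahedron a flat edge is
   contractible, so all edges of T are nonflat.  An edge of T' that is not a
   frame edge comes from an edge of T, which lies on a nonfacial 3-cycle; lifting
   this 3-cycle to T' gives either a nonfacial 3-cycle or a path of length 3 from
   u'_i to v'_i.  This is (1) for T', with "not contractible" strengthened to
   "not flat".  The two claims then pass from T1 to the contraction of an edge ac
   of T1: a nonfacial 3-cycle becomes a face only if a or c has degree 3 and the
   3-cycle is its link; then all edges at this vertex h are flat, and the short
   paths through h in T1 can be rerouted along the edges of the 3-cycle. *)

Set Implicit Arguments.
Unset Strict Implicit.
Unset Printing Implicit Defensive.

Section Triples.
Variable V : finType.
Implicit Types (x y z : V) (f : {set V}).

Lemma set3C x y z : [set x; y; z] = [set y; x; z].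
Proof. by rewrite (setUC [set x]). Qed.

Lemma set3AC x y z : [set x; y; z] = [set x; z; y].
Proof. by rewrite setUAC. Qed.

Lemma set3_rot x y z : [set x; y; z] = [set y; z; x].
Proof. by rewrite set3C set3AC. Qed.

Lemma cards3 x y z :
  (#|[set x; y; z]| == 3) = [&& x != y, x != z & y != z].
Proof.
rewrite setUC cardsU1 cards2 !inE negb_or !(eq_sym z).
by case: (x == y); case: (x == z); case: (y == z).
Qed.

Lemma eq_set3 f x y z : #|f| = 3 -> x \in f -> y \in f -> z \in f ->
  x != y -> x != z -> y != z -> f = [set x; y; z].
Proof.
move=> f3 xf yf zf xy xz yz; apply/eqP; rewrite eq_sym eqEcard f3.
have /eqP-> : #|[set x; y; z]| == 3 by rewrite cards3 xy xz yz.
by rewrite andbT; apply/subsetP=> t; rewrite !inE => /orP[/orP[]|] /eqP->.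
Qed.

Lemma card3_third f x y : #|f| = 3 -> x \in f -> y \in f -> x != y ->
  exists z, f = [set x; y; z].
Proof.
move=> f3 xf yf xy.
have : 0 < #|f :\ x :\ y|.
  by move: f3; rewrite (cardsD1 x) xf (cardsD1 y (f :\ x)) !inE eq_sym xy yf /= !add1n => -[->].
case/card_gt0P=> z; rewrite !inE => /and3P[zy zx zf].
by exists z; apply: eq_set3; rewrite // eq_sym.
Qed.

Lemma third_inj x y p q : x != p -> y != p ->
  [set x; y; p] = [set x; y; q] -> p = q.
Proof.
move=> xp yp /setP/(_ p); rewrite !inE eqxx orbT.
by rewrite !(eq_sym p) (negPf xp) (negPf yp) /= => /esym/eqP.
Qed.

End Triples.

Section Faces.
Variable V : finType.
Implicit Types (T : {set {set V}}) (x y z a c : V) (f e : {set V}).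

Definition pure T := forall f, f \in T -> #|f| = 3.

Lemma face_neq T x y z : pure T -> [set x; y; z] \in T ->
  [/\ x != y, x != z & y != z].
Proof. by move=> pT /pT/eqP; rewrite cards3 => /and3P. Qed.

Lemma adj_sym T x y : adj T x y = adj T y x.
Proof. by rewrite /adj setUC. Qed.

Lemma adj_neq T x y : adj T x y -> x != y.
Proof. by rewrite /adj inE cards2; case: (x != y). Qed.

Lemma adj_face T x y : adj T x y ->
  x != y /\ exists f, [/\ f \in T, x \in f & y \in f].
Proof.
move=> xy; split; first exact: adj_neq xy.
move: xy; rewrite /adj inE => /andP[_ /exists_inP[f fT]].
by rewrite subUset !sub1set => /andP[xf yf]; exists f.
Qed.

Lemma adjI T f x y : f \in T -> x \in f -> y \in f -> x != y -> adj T x y.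
Proof.
move=> fT xf yf xy; rewrite /adj inE cards2 xy /=; apply/exists_inP; exists f => //.
by rewrite subUset !sub1set xf.
Qed.

Lemma adjP T x y : pure T -> adj T x y -> exists z, [set x; y; z] \in T.
Proof.
move=> pT /adj_face[xy [f [fT xf yf]]].
by have [z fE] := card3_third (pT f fT) xf yf xy; exists z; rewrite -fE.
Qed.

Lemma face_adj T x y z : pure T -> [set x; y; z] \in T ->
  [/\ adj T x y, adj T x z & adj T y z].
Proof.
move=> pT xyz; have [xy xz yz] := face_neq pT xyz.
by split; apply: (adjI xyz); rewrite // !inE eqxx ?orbT.
Qed.

Lemma edgeP T e : e \in edges T -> exists x y, e = [set x; y] /\ adj T x y.
Proof.
move=> eT; have : #|e| == 2 by move: eT; rewrite inE => /andP[].
by case/cards2P=> x [y [xy eE]]; exists x, y; rewrite /adj -eE.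
Qed.

Lemma vertexP T x : pure T -> x \in vertices T -> exists y z, [set x; y; z] \in T.
Proof.
move=> pT /bigcupP[f fT xf].
have /card_gt0P[y] : 0 < #|f :\ x|.
  by have := pT f fT; rewrite (cardsD1 x) xf add1n => -[->].
rewrite !inE eq_sym => /andP[xy yf].
by have [z fE] := card3_third (pT f fT) xf yf xy; exists y, z; rewrite -fE.
Qed.

Lemma face_vertex T f x : f \in T -> x \in f -> x \in vertices T.
Proof. by move=> fT xf; apply/bigcupP; exists f. Qed.

Lemma adj_vertex T x y : adj T x y -> x \in vertices T.
Proof. by case/adj_face=> _ [f [fT xf _]]; apply: face_vertex fT xf. Qed.

Definition two_faces T x y := exists p q,
  [/\ p != q, [set x; y; p] \in T, [set x; y; q] \in T &
      forall r, [set x; y; r] \in T -> r = p \/ r = q].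

Lemma two_facesC T x y : two_faces T x y -> two_faces T y x.
Proof.
case=> p [q [pq xp xq all]]; exists p, q; split=> //; try by rewrite set3C.
by move=> r; rewrite set3C => /all.
Qed.

Lemma tri_two_faces T x y : triangulation T -> adj T x y -> two_faces T x y.
Proof.
move=> TT xy; have pT := tri_face TT; have nxy := adj_neq xy.
have /eqP/cards2P[f [g [fg fgE]]] := tri_edge TT xy.
have faceI h : h \in T -> [set x; y] \subset h -> exists p, h = [set x; y; p].
  by rewrite subUset !sub1set => hT /andP[xh yh]; apply: card3_third (pT h hT) _ _ _.
have inE1 h : (h \in [set f; g]) = (h \in T) && ([set x; y] \subset h).
  by rewrite -fgE inE.
have /andP[fT xf] : (f \in T) && ([set x; y] \subset f) by rewrite -inE1 set21.
have /andP[gT xg] : (g \in T) && ([set x; y] \subset g) by rewrite -inE1 set22.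
have [p fE] := faceI f fT xf; have [q gE] := faceI g gT xg.
exists p, q; split; rewrite -?fE -?gE //.
  by apply: contraNneq fg => pq; rewrite fE gE pq.
move=> r xyr; have : [set x; y; r] \in [set f; g] by rewrite inE1 xyr subsetUl.
have [_ xr yr] := face_neq pT xyr.
by rewrite !inE => /orP[] /eqP rE; [left|right]; apply: (third_inj xr yr);
  rewrite rE.
Qed.

Lemma two_faces_edge T e : pure T ->
  (forall x y, adj T x y -> two_faces T x y) ->
  e \in edges T -> #|[set f in T | e \subset f]| = 2.
Proof.
move=> pT two /edgeP[x [y [-> xy]]].
have nxy := adj_neq xy.
have [p [q [pq xp xq all]]] := two x y xy.
have -> : [set f in T | [set x; y] \subset f] = [set [set x; y; p]; [set x; y; q]].
  apply/setP=> f; rewrite !inE; apply/andP/orP.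
    case=> fT; rewrite subUset !sub1set => /andP[xf yf].
    have [r fE] := card3_third (pT f fT) xf yf nxy.
    by move: fT; rewrite fE => /all[]->; rewrite eqxx; [left|right].
  by case=> /eqP->; rewrite subsetUl.
have [_ xp' yp'] := face_neq pT xp.
rewrite cards2; case: (eqVneq [set x; y; p]) => [E|//]; by rewrite (third_inj xp' yp' E) eqxx in pq.
Qed.

End Faces.

Lemma connect_ind_pred (V : finType) (e : rel V) (P : V -> Prop) x y :
  (forall u v, P u -> e u v -> P v) -> P x -> connect e x y -> P y.
Proof.
move=> step Px /connectP[p pth ->]; elim: p x Px pth => //= z p IH x Px.
by case/andP=> xz; apply: IH; apply: step Px xz.
Qed.

Section Contract.
Variables (V : finType) (T : {set {set V}}) (a c : V).
Hypotheses (pT : pure T) (nac : a != c).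
Implicit Types (x y z h : V) (f g : {set V}).
Local Notation m := (Defs.merge a c).
Local Notation T2 := (contract T a c).

Lemma merge_neq x : x != c -> m x = x.
Proof. by rewrite /Defs.merge => /negPf->. Qed.

Lemma merge_l : m a = a.
Proof. exact: merge_neq. Qed.

Lemma merge_r : m c = a.
Proof. by rewrite /Defs.merge eqxx. Qed.

Lemma merge_neq_r x : m x != c.
Proof. by rewrite /Defs.merge; case: ifP => // /negbT. Qed.

Lemma merge_eq_l x : m x = a -> x = a \/ x = c.
Proof. by rewrite /Defs.merge; case: eqP; auto. Qed.

Lemma merge_eq x y : x != a -> m y = x -> y = x.
Proof. by rewrite /Defs.merge; case: (y =P c) => // _ xa ax; rewrite ax eqxx in xa. Qed.

Lemma merge_inj x y : m x = m y ->
  [\/ x = y, x = a /\ y = c | x = c /\ y = a].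
Proof.
rewrite /Defs.merge; case: (eqVneq x c); case: (eqVneq y c) => yc xc E; subst.
- by constructor 1.
- by constructor 3.
- by constructor 2.
- by constructor 1.
Qed.

Lemma contractP f :
  reflect (exists g, [/\ g \in T, ~~ ((a \in g) && (c \in g)) & f = m @: g])
          (f \in T2).
Proof.
apply: (iffP imsetP) => [[g]|[g [gT acg fE]]].
  by rewrite inE subUset !sub1set => /andP[gT acg] fE; exists g.
by exists g; rewrite // inE subUset !sub1set gT.
Qed.

Lemma merge_injP g : ~~ ((a \in g) && (c \in g)) -> {in g &, injective m}.
Proof.
move=> acg x y xg yg /merge_inj[//|[xE yE]|[xE yE]]; case/negP: acg; subst.
  by rewrite xg.
by rewrite yg.
Qed.

Lemma contract_pure : pure T2.
Proof.
by move=> _ /contractP[g [gT acg ->]]; rewrite card_in_imset ?pT //; apply: merge_injP.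
Qed.

Lemma contract_neq f x : f \in T2 -> x \in f -> x != c.
Proof. by case/contractP=> g [_ _ ->] /imsetP[y _ ->]; apply: merge_neq_r. Qed.

Lemma merge_set3 x y z : m @: [set x; y; z] = [set m x; m y; m z].
Proof. by rewrite !imsetU !imset_set1. Qed.

Lemma face_contract x y z : [set x; y; z] \in T ->
  x != c -> y != c -> z != c -> [set x; y; z] \in T2.
Proof.
move=> xyz xc yc zc; apply/contractP; exists [set x; y; z]; split=> //.
  by rewrite !inE !(eq_sym c) (negPf xc) (negPf yc) (negPf zc) andbF.
by rewrite merge_set3 !merge_neq.
Qed.

Lemma face_contract_at h y z : h = a \/ h = c -> [set h; y; z] \in T ->
  y != a -> y != c -> z != a -> z != c -> [set a; y; z] \in T2.
Proof.
move=> hac hyz ya yc za zc; apply/contractP; exists [set h; y; z]; split=> //.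
  rewrite !inE !(eq_sym c) !(eq_sym a) (negPf ya) (negPf yc) (negPf za) (negPf zc).
  by rewrite !orbF; case: hac => ->; rewrite ?(negPf nac) ?andbF // (eq_sym c) (negPf nac).
by rewrite merge_set3 !(merge_neq yc) !(merge_neq zc); case: hac => ->;
   rewrite ?merge_l ?merge_r.
Qed.

Lemma contract3 x y z : [set x; y; z] \in T2 -> exists x' y' z',
  [/\ m x' = x, m y' = y, m z' = z & [set x'; y'; z'] \in T].
Proof.
move=> xyz; have [xy xz yz] := face_neq contract_pure xyz.
have [g [gT _ gE]] := contractP _ xyz.
have pre t : t \in [set x; y; z] -> exists2 t', t' \in g & m t' = t.
  by rewrite gE => /imsetP[t' t'g ->]; exists t'.
have [|x' x'g x'E] := pre x; first by rewrite !inE eqxx.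
have [|y' y'g y'E] := pre y; first by rewrite !inE eqxx orbT.
have [|z' z'g z'E] := pre z; first by rewrite !inE eqxx !orbT.
have neq t s : m t != m s -> t != s by apply: contraNneq => ->.
exists x', y', z'; split=> //; rewrite -(eq_set3 (pT gT) x'g y'g z'g) //;
  by apply: neq; rewrite ?x'E ?y'E ?z'E.
Qed.

Lemma contract3_off x y z : [set x; y; z] \in T2 ->
  x != a -> y != a -> z != a -> [set x; y; z] \in T.
Proof.
move=> /contract3[x' [y' [z' [xE yE zE xyz]]]] xa ya za.
by rewrite -(merge_eq xa xE) -(merge_eq ya yE) -(merge_eq za zE).
Qed.

Lemma contract3_at y z : [set a; y; z] \in T2 -> exists h,
  (h = a \/ h = c) /\ [set h; y; z] \in T.
Proof.
move=> ayz; have [ay az _] := face_neq contract_pure ayz.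
have [h [y' [z' [hE yE zE hyz]]]] := contract3 ayz.
rewrite eq_sym in ay; rewrite eq_sym in az.
exists h; split; first exact: merge_eq_l.
by rewrite -(merge_eq ay yE) -(merge_eq az zE).
Qed.

Lemma adj_contract_inv x y : adj T2 x y -> exists x' y',
  [/\ m x' = x, m y' = y & adj T x' y'].
Proof.
case/(adjP contract_pure)=> z /contract3[x' [y' [z' [xE yE _ xyz]]]].
by exists x', y'; split=> //; case: (face_adj pT xyz).
Qed.

Lemma adj_contract_neq x y : adj T2 x y -> x != c /\ y != c.
Proof. by case/adj_face=> _ [f [fT xf yf]]; split; apply: contract_neq fT _. Qed.

Lemma adj_contract_off x y : x != a -> y != a -> adj T2 x y -> adj T x y.
Proof.
by move=> xa ya /adj_contract_inv[x' [y' [/(merge_eq xa)-> /(merge_eq ya)->]]].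
Qed.

Lemma adj_contract_at y : y != a -> adj T2 a y ->
  exists h, (h = a \/ h = c) /\ adj T h y.
Proof.
move=> ya /adj_contract_inv[h [y' [/merge_eq_l hE /(merge_eq ya)-> hy]]].
by exists h.
Qed.

End Contract.

Definition flat (V : finType) (T : {set {set V}}) (x y : V) : bool :=
  adj T x y && [forall z, adj T x z ==> adj T y z ==> ([set x; y; z] \in T)].

(* What survives in [pre_irreducible T w side] of the axioms of a triangulation
   without a study of the added faces; [Fr] is the set of frame vertices. *)
Record near_triangulation (V : finType) (Fr : {set V}) (T : {set {set V}}) :
    Prop := NearTriangulation {
  near_face : pure T;
  near_edge : forall x y, adj T x y -> x \notin Fr -> exists p q,
    [/\ p != q, [set x; y; p] \in T & [set x; y; q] \in T];
  near_apex : forall a c z p r, a \notin Fr -> c \notin Fr -> a != c ->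
    [set a; z; p] \in T -> [set c; z; p] \in T -> [set r; z; p] \in T ->
    r = a \/ r = c;
  near_deg3 : forall c x y z, c \notin Fr ->
    [set c; x; y] \in T -> [set c; x; z] \in T -> [set c; y; z] \in T ->
    forall t, adj T c t -> t \in [set x; y; z]
}.

Section Near.
Variable V : finType.
Implicit Types (T : {set {set V}}) (Fr : {set V}) (x y z a c : V).

Lemma flatP T x y : reflect
  (adj T x y /\ forall z, adj T x z -> adj T y z -> [set x; y; z] \in T)
  (flat T x y).
Proof.
apply: (iffP andP) => -[xy allz]; split=> //.
  by move=> z xz yz; have /forallP/(_ z) := allz; rewrite xz yz.
by apply/forallP=> z; apply/implyP=> xz; apply/implyP=> yz; apply: allz.
Qed.

Lemma flat_adj T x y : flat T x y -> adj T x y.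
Proof. by case/flatP. Qed.

Lemma flat_face T x y z : flat T x y -> adj T x z -> adj T y z ->
  [set x; y; z] \in T.
Proof. by case/flatP=> _; apply. Qed.

Lemma flatC T x y : flat T x y = flat T y x.
Proof.
rewrite /flat adj_sym; congr (_ && _); apply: eq_forallb => z.
by rewrite set3C; case: (adj T x z); case: (adj T y z).
Qed.

Lemma flatPn T x y : adj T x y -> ~~ flat T x y ->
  exists z, [/\ adj T x z, adj T y z & [set x; y; z] \notin T].
Proof.
rewrite /flat => -> /= /forallPn[z]; rewrite !negb_imply => /and3P[xz yz xyz].
by exists z.
Qed.

Lemma tri_deg3 T c x y z : triangulation T ->
  [set c; x; y] \in T -> [set c; x; z] \in T -> [set c; y; z] \in T ->
  forall t, adj T c t -> t \in [set x; y; z].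
Proof.
move=> TT cxy cxz cyz t ct; have pT := tri_face TT.
have [cx cy _] := face_adj pT cxy; have [_ cz _] := face_adj pT cxz.
have [[_ _ xy] [_ _ xz] [_ _ yz]] :=
  And3 (face_neq pT cxy) (face_neq pT cxz) (face_neq pT cyz).
have only s s1 s2 r : adj T c s -> s1 != s2 -> [set c; s; s1] \in T ->
    [set c; s; s2] \in T -> [set c; s; r] \in T -> r = s1 \/ r = s2.
  move=> cs s12 h1 h2 h3; have [p [q [_ _ _ all]]] := tri_two_faces TT cs.
  by move: s12; case: (all _ h1) => ->; case: (all _ h2) => ->;
     case: (all _ h3) => ->; rewrite ?eqxx //; auto.
have cyx : [set c; y; x] \in T by rewrite set3AC.
have czx : [set c; z; x] \in T by rewrite set3AC.
have czy : [set c; z; y] \in T by rewrite set3AC.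
have step u v : u \in [set x; y; z] -> [set c; u; v] \in T -> v \in [set x; y; z].
  rewrite !inE -orbA => /or3P[]/eqP->.
  - by case/(only x y z v cx yz cxy cxz) => ->; rewrite eqxx ?orbT.
  - by case/(only y x z v cy xz cyx cyz) => ->; rewrite eqxx ?orbT.
  - by case/(only z x y v cz xy czx czy) => ->; rewrite eqxx ?orbT.
by apply: (connect_ind_pred step _ (tri_link TT cx ct)); rewrite !inE eqxx.
Qed.

Lemma near_tri T Fr : triangulation T -> near_triangulation Fr T.
Proof.
move=> TT; have pT := tri_face TT; split=> //.
- move=> x y xy _; have [p [q [pq xp xq _]]] := tri_two_faces TT xy.
  by exists p, q.
- move=> a c z p r _ _ ac; rewrite 3!(set3_rot _ z) => azp czp rzp.
  have [zp _ _] := face_adj pT azp.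
  have [s [t [_ _ _ all]]] := tri_two_faces TT zp.
  by move: ac; case: (all _ azp) => ->; case: (all _ czp) => ->;
     case: (all _ rzp) => ->; rewrite ?eqxx //; auto.
- by move=> c x y z _; apply: tri_deg3.
Qed.

(* If a c z were a nonfacial 3-cycle, the two faces at a z and the two at c z
   would have the same apexes p, q, and after the contraction the edge z p would
   lie on a single face. *)
Lemma contract_flat T Fr a c : near_triangulation Fr T ->
  a \notin Fr -> c \notin Fr -> adj T a c -> triangulation (contract T a c) ->
  flat T a c.
Proof.
move=> nT aF cF ac T2T; have pT := near_face nT; have nac := adj_neq ac.
apply: contraT => /(flatPn ac)[z [az cz acz]].
have [p [q [pq azp azq]]] := near_edge nT az aF.
have [r [_ [_ czr _]]] := near_edge nT cz cF.
have off h s : h = a \/ h = c -> [set h; z; s] \in T -> [&& s != a, s != c, z != a & z != c].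
  move=> hac hzs; have [hz hs zs] := face_neq pT hzs.
  rewrite (eq_sym z) (adj_neq az) (eq_sym z) (adj_neq cz) !andbT.
  case: hac => hE; subst h; rewrite (eq_sym _ s) in hs; rewrite hs ?andbT /=.
    by apply: contraNneq acz => sE; rewrite set3AC -sE.
  by apply: contraNneq acz => sE; rewrite -set3_rot set3AC set3_rot -sE set3AC.
have/and4P[pa pc za zc] := off a p (or_introl erefl) azp.
have/and4P[qa qc _ _] := off a q (or_introl erefl) azq.
have/and4P[ra rc _ _] := off c r (or_intror erefl) czr.
have azp2 := face_contract_at nac (or_introl erefl) azp za zc pa pc.
have azq2 := face_contract_at nac (or_introl erefl) azq za zc qa qc.
have azr2 := face_contract_at nac (or_intror erefl) czr za zc ra rc.
have [s [sa azs czs]] : exists s, [/\ s != a, [set a; z; s] \in T & [set c; z; s] \in T].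
  have [az2 _ _] := face_adj (tri_face T2T) azp2.
  have [t [u [_ _ _ all]]] := tri_two_faces T2T az2.
  have [rE|rE] : r = p \/ r = q.
    by move: pq; case: (all _ azp2) => ->; case: (all _ azq2) => ->;
     case: (all _ azr2) => ->; rewrite ?eqxx //; auto.
  - by exists p; rewrite -{3}rE.
  - by exists q; rewrite -{3}rE.
have/and4P[_ sc _ _] := off a s (or_introl erefl) azs.
have azs2 := face_contract_at nac (or_introl erefl) azs za zc sa sc.
have [_ _ zs2] := face_adj (tri_face T2T) azs2.
have [t [u [tu zst zsu _]]] := tri_two_faces T2T zs2.
have [v va zsv] : exists2 v, v != a & [set z; s; v] \in contract T a c.
  case: (eqVneq t a) => ta; last by exists t.
  by exists u; rewrite // eq_sym -ta.
have vzs := contract3_off pT nac zsv za sa va; rewrite -set3_rot in vzs.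
case: (near_apex nT aF cF nac azs czs vzs) => vE; first by rewrite vE eqxx in va.
by have := contract_neq nac zsv (x := v); rewrite !inE vE eqxx orbT => /(_ isT).
Qed.

End Near.

Section Walks.
Variable V : finType.
Implicit Types (T : {set {set V}}) (u v p q x y : V).

Definition eq_or_adj T x y : bool := (x == y) || adj T x y.

(* u p q v is a path from u to v of length at most 3, consecutive equal
   vertices being identified. *)
Definition lazy_path T u v p q : bool :=
  [&& p != v, q != u, eq_or_adj T u p, eq_or_adj T p q & eq_or_adj T q v].

Definition same_edge x y u v : bool :=
  (x == u) && (y == v) || (x == v) && (y == u).

Definition on_lazy_path u v p q x y : bool :=
  [|| same_edge x y u p, same_edge x y p q | same_edge x y q v].

Lemma eq_or_adj_sym T x y : eq_or_adj T x y = eq_or_adj T y x.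
Proof. by rewrite /eq_or_adj eq_sym adj_sym. Qed.

Lemma eq_or_adj_refl T x : eq_or_adj T x x.
Proof. by rewrite /eq_or_adj eqxx. Qed.

Lemma lazy_path_rev T u v p q : lazy_path T u v p q = lazy_path T v u q p.
Proof.
rewrite /lazy_path (eq_or_adj_sym T u p) (eq_or_adj_sym T p q) (eq_or_adj_sym T q v).
by apply/and5P/and5P => -[? ? ? ? ?]; split.
Qed.

Lemma same_edgeC x y u v : same_edge x y u v = same_edge y x u v.
Proof. by rewrite /same_edge orbC; congr (_ || _); rewrite andbC. Qed.

Lemma same_edge_rev x y u v : same_edge x y u v = same_edge x y v u.
Proof. by rewrite /same_edge orbC. Qed.

Lemma on_lazy_pathC u v p q x y : on_lazy_path u v p q x y = on_lazy_path u v p q y x.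
Proof. by rewrite /on_lazy_path !(same_edgeC x). Qed.

Lemma on_lazy_path_rev u v p q x y :
  on_lazy_path u v p q x y = on_lazy_path v u q p x y.
Proof.
rewrite /on_lazy_path (same_edge_rev _ _ u p) (same_edge_rev _ _ p q) (same_edge_rev _ _ q v).
by case: same_edge; case: same_edge; case: same_edge.
Qed.

Lemma on_lazy_path_inner u v p q x y :
  on_lazy_path u v p q x y -> x != u -> x != v -> x = p \/ x = q.
Proof.
by move=> /or3P[]/orP[]/andP[/eqP-> _]; rewrite ?eqxx //; auto.
Qed.

Lemma lazy_path_short T u v p q : u != v -> lazy_path T u v p q ->
  exists s, [/\ short_path T u v s,
    forall x y, x != y -> on_lazy_path u v p q x y -> edge_on_path x y (u :: s) &
    forall x, x = p \/ x = q -> x \in u :: s].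
Proof.
move=> uv /and5P[pv qu up pq qv].
have adjE x y : x != y -> eq_or_adj T x y -> adj T x y.
  by rewrite /eq_or_adj => /negPf->.
have sub x y u' v' s : x != y -> same_edge x y u' v' ->
    (u' != v' -> edge_on_path u' v' s) -> edge_on_path x y s.
  move=> xy /orP[]/andP[/eqP xE /eqP yE] H; subst; first exact: H.
  by rewrite /edge_on_path orbC; apply: H; rewrite eq_sym.
have fin s : short_path T u v s ->
    (u != p -> edge_on_path u p (u :: s)) -> (p != q -> edge_on_path p q (u :: s)) ->
    (q != v -> edge_on_path q v (u :: s)) ->
    (p \in u :: s) && (q \in u :: s) ->
  exists s, [/\ short_path T u v s,
    forall x y, x != y -> on_lazy_path u v p q x y -> edge_on_path x y (u :: s) &
    forall x, x = p \/ x = q -> x \in u :: s].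
  move=> sp e1 e2 e3 /andP[ps qs]; exists s; split=> //; last by move=> x [->|->].
  by move=> x y xy /or3P[] E; apply: sub E _.
rewrite /short_path /edge_on_path in fin *.
case: (eqVneq u p) => [E|nup].
  subst p; rewrite eq_sym in qu; have uq := adjE _ _ qu pq.
  case: (eqVneq q v) => [E|nqv].
    subst q; apply: (fin [:: v]); rewrite /= ?inE ?negb_or ?eqxx ?uq ?uv ?orbT //.
  have qv' := adjE _ _ nqv qv.
  by apply: (fin [:: q; v]); rewrite /= ?inE ?negb_or ?eqxx ?uq ?qv' ?uv ?qu ?nqv ?orbT.
have up' := adjE _ _ nup up.
case: (eqVneq p q) => [E|npq].
  subst q; have qv' := adjE _ _ pv qv.
  by apply: (fin [:: p; v]); rewrite /= ?inE ?negb_or ?eqxx ?up' ?qv' ?uv ?nup ?pv ?orbT.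
have pq' := adjE _ _ npq pq.
case: (eqVneq q v) => [E|nqv].
  subst q; apply: (fin [:: p; v]); rewrite /= ?inE ?negb_or ?eqxx ?up' ?pq' ?uv ?nup ?pv ?orbT //.
have qv' := adjE _ _ nqv qv; rewrite eq_sym in qu.
by apply: (fin [:: p; q; v]);
   rewrite /= ?inE ?negb_or ?eqxx ?up' ?pq' ?qv' ?uv ?nup ?npq ?nqv ?pv ?qu ?orbT.
Qed.

End Walks.

Section Descent.
Variables (V : finType) (Fr : {set V}) (T : {set {set V}}) (a c : V).
Hypotheses (nT : near_triangulation Fr T) (aF : a \notin Fr) (cF : c \notin Fr).
Hypothesis fac : flat T a c.
Implicit Types (x y z h k u v p q : V).
Local Notation m := (Defs.merge a c).
Local Notation T2 := (contract T a c).

Let pT := near_face nT.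
Let ac := flat_adj fac.
Let nac := adj_neq ac.
Let pT2 := contract_pure pT nac.

Definition ends h k := (h = a /\ k = c) \/ (h = c /\ k = a).

Lemma ends_sym h k : ends h k -> ends k h.
Proof. by case=> -[-> ->]; [right|left]. Qed.

Lemma ends_fst h k : ends h k -> h = a \/ h = c.
Proof. by case=> -[]; auto. Qed.

Lemma ends_of h : h = a \/ h = c -> exists k, ends h k.
Proof. by case=> ->; [exists c; left|exists a; right]. Qed.

Lemma ends_Fr h k : ends h k -> h \notin Fr.
Proof. by case=> -[-> _]. Qed.

Lemma ends_flat h k : ends h k -> flat T h k.
Proof. by case=> -[-> ->] //; rewrite flatC. Qed.

Lemma ends_merge h k : ends h k -> m h = a.
Proof. by case=> -[-> _]; rewrite ?merge_l ?merge_r. Qed.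

Lemma merge_off x : x \in Fr -> m x = x.
Proof. by move=> xF; apply: merge_neq; apply: contraNneq cF => <-. Qed.

Lemma adj_contract x y : adj T x y -> m x != m y -> adj T2 (m x) (m y).
Proof.
move=> xy mxy.
have img f : f \in T -> x \in f -> y \in f -> ~~ ((a \in f) && (c \in f)) ->
    adj T2 (m x) (m y).
  move=> fT xf yf acf; apply: (adjI (f := m @: f)) => //; try exact: imset_f.
  by apply/(contractP); exists f.
have at_end h k t : ends h k -> adj T h t -> t != k ->
    exists f, [/\ f \in T, h \in f, t \in f & k \notin f].
  move=> hk ht tk.
  have [p [q [pq hp hq]]] := near_edge nT ht (ends_Fr hk).
  have hk' := adj_neq (flat_adj (ends_flat hk)).
  case: (eqVneq p k) => [pk|pk].
    exists [set h; t; q]; split; rewrite ?inE ?eqxx ?orbT //.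
    by rewrite !negb_or !(eq_sym k) hk' tk -pk eq_sym.
  exists [set h; t; p]; split; rewrite ?inE ?eqxx ?orbT //.
  by rewrite !negb_or !(eq_sym k) hk' tk.
have fin h k (f : {set V}) : ends h k -> k \notin f -> ~~ ((a \in f) && (c \in f)).
  by case=> -[_ ->] /negPf->; rewrite ?andbF.
have neq h k : ends h k -> m h = m k.
  by move=> hk; rewrite (ends_merge hk) (ends_merge (ends_sym hk)).
have [z xyz] := adjP pT xy.
case: (boolP ((x == a) || (x == c))) => [/orP xac|].
  have [k xk] : exists k, ends x k by apply: ends_of; case: xac => /eqP; auto.
  have yk : y != k by apply: contraNneq mxy => ->; rewrite (neq _ _ xk).
  by have [f [fT xf yf kf]] := at_end _ _ _ xk xy yk; apply: img _ fT xf yf (fin _ _ _ xk kf).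
rewrite negb_or => /andP[xa xc].
case: (boolP ((y == a) || (y == c))) => [/orP yac|].
  have [k yk] : exists k, ends y k by apply: ends_of; case: yac => /eqP; auto.
  have xk : x != k by apply: contraNneq mxy => ->; rewrite (neq _ _ yk).
  rewrite adj_sym in xy.
  by have [f [fT yf xf kf]] := at_end _ _ _ yk xy xk; apply: img _ fT xf yf (fin _ _ _ yk kf).
rewrite negb_or => /andP[ya yc].
apply: (img [set x; y; z]); rewrite ?inE ?eqxx ?orbT //.
rewrite !(eq_sym a) !(eq_sym c) (negPf xa) (negPf xc) (negPf ya) (negPf yc) /=.
by apply: contraNN nac => /andP[/eqP<-].
Qed.

Lemma adj_contract_neq2 x y : x != c -> y != c -> adj T x y -> adj T2 x y.
Proof.
move=> xc yc xy; have := adj_contract xy; rewrite !merge_neq //; apply.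
exact: adj_neq xy.
Qed.

Lemma adj_contract_end h k y : ends h k -> y != a -> y != c -> adj T h y -> adj T2 a y.
Proof.
move=> hk ya yc hy; have := adj_contract hy; rewrite (ends_merge hk) merge_neq //.
by apply; rewrite eq_sym.
Qed.

Lemma eq_or_adj_contract x y : eq_or_adj T x y -> eq_or_adj T2 (m x) (m y).
Proof.
case/orP=> [/eqP->|xy]; first exact: eq_or_adj_refl.
by rewrite /eq_or_adj; case: eqVneq => //= mxy; apply: adj_contract.
Qed.

Lemma merge_neq_Fr x v : v \in Fr -> x != v -> m x != v.
Proof.
move=> vF xv; apply: contraNneq xv => mv; rewrite -mv merge_neq //.
by apply: contraNneq aF => xc; move: mv; rewrite xc merge_r => ->.
Qed.

Lemma lazy_path_contract u v p q : u \in Fr -> v \in Fr ->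
  lazy_path T u v p q -> lazy_path T2 u v (m p) (m q).
Proof.
move=> uF vF /and5P[pv qu up pq qv].
rewrite /lazy_path !merge_neq_Fr //=.
move: (eq_or_adj_contract up) (eq_or_adj_contract pq) (eq_or_adj_contract qv).
by rewrite (merge_off uF) (merge_off vF) => -> -> ->.
Qed.

Lemma on_lazy_path_contract u v p q x y : u \in Fr -> v \in Fr ->
  on_lazy_path u v p q x y -> on_lazy_path u v (m p) (m q) (m x) (m y).
Proof.
move=> uF vF.
have img s t : same_edge x y s t -> same_edge (m x) (m y) (m s) (m t).
  by rewrite /same_edge => /orP[]/andP[/eqP-> /eqP->]; rewrite !eqxx ?orbT.
by move=> /or3P[]/img; rewrite ?(merge_off uF) ?(merge_off vF) /on_lazy_path => ->;
   rewrite ?orbT.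
Qed.

(* A degree 3 vertex h disappears in the face x y a; a path through h can be
   rerouted along the edge x y. *)
Lemma deg3_lazy_path_fst h k x y u v q : ends h k ->
  x != a -> x != c -> y != a -> y != c ->
  adj T k x -> adj T k y -> adj T x y ->
  (forall t, adj T h t -> t \in [set k; x; y]) ->
  u \in Fr -> v \in Fr -> u != v -> lazy_path T u v h q ->
  exists p' q', lazy_path T2 u v p' q' /\ on_lazy_path u v p' q' x y.
Proof.
move=> hk xa xc ya yc kx ky xy nbr uF vF uv /and5P[hv qu uh hq qv].
have kF := ends_Fr (ends_sym hk); have hF := ends_Fr hk.
have outF t : t \in Fr -> t != a /\ t != c.
  by move=> tF; split; apply: contraTneq tF => ->.
have [ua uc] := outF u uF; have [va vc] := outF v vF.
have outk t : t \in Fr -> t != k by move=> tF; apply: contraTneq tF => ->.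
have outh t : t \in Fr -> t != h by move=> tF; apply: contraTneq tF => ->.
have uh' : adj T h u by move: uh; rewrite eq_or_adj_sym /eq_or_adj eq_sym (negPf (outh u uF)).
have [o [uo oE xyE]] : exists o, [/\ adj T2 u o, o != a /\ o != c &
    (x = u /\ y = o) \/ (y = u /\ x = o)].
  have := nbr u uh'; rewrite !inE (negPf (outk u uF)) /= => /orP[]/eqP uE.
    exists y; rewrite uE; split; auto; exact: adj_contract_neq2.
  exists x; rewrite uE adj_sym; split; auto; exact: adj_contract_neq2.
have on_uo q' : on_lazy_path u v o q' x y.
  by rewrite /on_lazy_path /same_edge; case: xyE => -[-> ->]; rewrite !eqxx ?orbT.
have nbr' t : adj T h t -> [\/ t = k, t = u | t = o].
  by move/nbr; rewrite !inE -orbA => /or3P[]/eqP->; case: xyE => -[xE yE]; subst; auto;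
     try (by constructor 1); try (by constructor 2); constructor 3.
have [oa oc] := oE; have ko : adj T k o by case: xyE => -[_ <-].
have vo : v = o -> exists p' q', lazy_path T2 u v p' q' /\ on_lazy_path u v p' q' x y.
  move=> E; subst o; exists u, v; split; last first.
    by rewrite /on_lazy_path /same_edge; case: xyE => -[-> ->]; rewrite !eqxx ?orbT.
  by rewrite /lazy_path uv (eq_sym v) uv /= !eq_or_adj_refl /eq_or_adj uo orbT.
case: (eqVneq v o) => // vno; rewrite eq_sym in vno.
have uk : u != k by apply: outk.
have lov : adj T o v -> exists p' q', lazy_path T2 u v p' q' /\ on_lazy_path u v p' q' x y.
  move=> ov; exists o, o; split=> //; rewrite /lazy_path vno eq_or_adj_refl.
  by rewrite eq_sym (adj_neq uo) /eq_or_adj uo orbT /= adj_contract_neq2 ?orbT.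
have lqh : q = h -> exists p' q', lazy_path T2 u v p' q' /\ on_lazy_path u v p' q' x y.
  move=> E; subst q; move: qv; rewrite /eq_or_adj (negPf hv) /= => /nbr'.
  case=> E; [by move: (outk v vF); rewrite E eqxx|by rewrite E eqxx in uv|].
  exact: vo.
case/orP: hq => [/eqP/esym|/nbr'[] E]; first exact: lqh.
- subst q; move: qv; rewrite /eq_or_adj eq_sym (negPf (outk v vF)) /= => kv.
  exists o, a; split=> //; rewrite /lazy_path vno eq_sym ua /eq_or_adj uo orbT /=.
  rewrite adj_sym (adj_contract_end (ends_sym hk)) ?orbT //=.
  by rewrite (adj_contract_end (ends_sym hk)) ?orbT.
- by rewrite E eqxx in qu.
- by subst q; move: qv; rewrite /eq_or_adj (negPf vno) /=; apply: lov.
Qed.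

Lemma deg3_lazy_path h k x y u v p q : ends h k ->
  x != a -> x != c -> y != a -> y != c ->
  adj T k x -> adj T k y -> adj T x y ->
  (forall t, adj T h t -> t \in [set k; x; y]) ->
  u \in Fr -> v \in Fr -> u != v -> lazy_path T u v p q -> h = p \/ h = q ->
  exists p' q', lazy_path T2 u v p' q' /\ on_lazy_path u v p' q' x y.
Proof.
move=> hk xa xc ya yc kx ky xy nbr uF vF uv uvpq [] E; subst.
  exact: (deg3_lazy_path_fst hk xa xc ya yc kx ky xy nbr uF vF uv uvpq).
rewrite lazy_path_rev in uvpq.
have [] := (deg3_lazy_path_fst (k := k) hk xa xc ya yc kx ky xy nbr vF uF _ uvpq).
  by rewrite eq_sym.
by move=> p' [q' []]; rewrite lazy_path_rev on_lazy_path_rev; exists q', p'.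
Qed.

Lemma deg3 h k x y : ends h k -> x != a -> x != c -> y != a -> y != c ->
  [set h; x; y] \in T -> adj T k x -> adj T k y ->
  [/\ forall t, adj T h t -> t \in [set k; x; y], flat T h x &
      forall t, adj T h t -> flat T h t].
Proof.
move=> hk xa xc ya yc hxy kx ky; have fhk := ends_flat hk.
have [hx hy xy] := face_adj pT hxy; have hF := ends_Fr hk.
have hkx := flat_face fhk hx kx; have hky := flat_face fhk hy ky.
have nbr := near_deg3 nT hF hkx hky hxy.
have fh t : adj T h t -> flat T h t.
  move=> ht; apply/flatP; split=> // s /nbr; have := nbr t ht; rewrite !inE -!orbA.
  move=> /or3P[]/eqP-> /or3P[]/eqP-> ts;
  try (by move: (adj_neq ts); rewrite eqxx); rewrite // set3AC //.
by split=> //; apply: fh.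
Qed.

End Descent.

Section ShortPathProperties.
Variables (V : finType) (Fr : {set V}) (FrE : {set {set V}}) (u v : 'I_3 -> V).

Definition edges_on_paths (T : {set {set V}}) : Prop := forall x y,
  flat T x y -> [set x; y] \notin FrE -> exists i p q,
    lazy_path T (u i) (v i) p q /\ on_lazy_path (u i) (v i) p q x y.

Definition on_path (T : {set {set V}}) (i : 'I_3) (x : V) : Prop := exists p q,
  lazy_path T (u i) (v i) p q /\ (x = p \/ x = q).

Definition vertices_on_paths (T : {set {set V}}) : Prop := forall x,
  x \in vertices T -> x \notin Fr -> (forall y, adj T x y -> flat T x y) ->
  exists i j, [/\ i != j, on_path T i x & on_path T j x].

Variables (T : {set {set V}}) (a c : V).
Hypotheses (nT : near_triangulation Fr T) (aF : a \notin Fr) (cF : c \notin Fr).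
Hypothesis fac : flat T a c.
Hypotheses (FrE_Fr : forall x y, [set x; y] \in FrE -> x \in Fr)
  (uF : forall i, u i \in Fr) (vF : forall i, v i \in Fr)
  (uv : forall i, u i != v i).
Local Notation m := (Defs.merge a c).
Local Notation T2 := (contract T a c).

Let pT := near_face nT.
Let ac := flat_adj fac.
Let nac := adj_neq ac.
Let pT2 := contract_pure pT nac.

Lemma edges_on_paths_contract : edges_on_paths T -> edges_on_paths T2.
Proof.
move=> PT x y fxy xyE.
have lift x' y' : flat T x' y' -> m x' = x -> m y' = y -> exists i p q,
    lazy_path T2 (u i) (v i) p q /\ on_lazy_path (u i) (v i) p q x y.
  move=> fxy' xE yE; have [|i [p [q [uvpq on]]]] := PT x' y' fxy'.
    apply: contraNN xyE => E; have := FrE_Fr E; have := E.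
    rewrite setUC => /FrE_Fr yF xF.
    by rewrite -xE -yE (merge_off a cF yF) (merge_off a cF xF).
  exists i, (m p), (m q); rewrite (lazy_path_contract nT) //.
  by rewrite -xE -yE; split=> //; apply: (on_lazy_path_contract a cF).
have off x' y' : adj T2 x' y' -> x' != a -> y' != a -> flat T2 x' y' -> ~~ flat T x' y' ->
    exists h k, [/\ ends a c h k, [set h; x'; y'] \in T, adj T k x' & adj T k y'].
  move=> xy2 xa ya f2 nf; have [xc yc] := adj_contract_neq nac xy2.
  have xy := adj_contract_off pT nac xa ya xy2.
  have [z [xz yz xyz]] := flatPn xy nf.
  have mxz : m x' != m z.
    rewrite merge_neq //; apply: contraNneq (adj_neq xz) => E.
    by rewrite (merge_eq xa (esym E)).
  have myz : m y' != m z.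
    rewrite merge_neq //; apply: contraNneq (adj_neq yz) => E.
    by rewrite (merge_eq ya (esym E)).
  have xz2 := adj_contract nT aF cF fac xz mxz.
  have yz2 := adj_contract nT aF cF fac yz myz.
  rewrite merge_neq // in xz2; rewrite merge_neq // in yz2.
  have xyz2 := flat_face f2 xz2 yz2.
  case: (boolP ((z == a) || (z == c))) => [/orP zac|].
    have [k zk] : exists k, ends a c z k by apply: ends_of; case: zac => /eqP; auto.
    rewrite (ends_merge fac zk) -set3_rot in xyz2.
    have [h [hac hxy]] := contract3_at pT nac xyz2.
    exists k, z; split; rewrite 1?adj_sym //; first exact: ends_sym.
    have [] : h = z \/ h = k by case: zk hac => -[-> ->] []; auto.
    + by move=> hz; rewrite set3_rot hz in hxy; rewrite hxy in xyz.
    + by move=> <-.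
  rewrite negb_or => /andP[za zc]; rewrite merge_neq // in xyz2.
  by rewrite (contract3_off pT nac xyz2) in xyz.
have at_end y' : flat T2 a y' -> exists h, m h = a /\ flat T h y'.
  move=> f2; have ay2 := flat_adj f2.
  have ya : y' != a by rewrite eq_sym (adj_neq ay2).
  have [_ yc] := adj_contract_neq nac ay2.
  have [h [hac hy]] := adj_contract_at pT nac ya ay2.
  have [k hk] := ends_of hac.
  case fhy: (flat T h y'); first by exists h; rewrite (ends_merge fac hk).
  have [z [hz yz hyz]] := flatPn hy (negbT fhy).
  have zh : z != h by rewrite eq_sym (adj_neq hz).
  have zk : z != k.
    apply: contraNneq hyz => E; subst z; rewrite set3AC.
    by rewrite (flat_face (ends_flat fac hk)) // adj_sym.
  have [za zc] : z != a /\ z != c by case: hk zh zk => -[-> ->] *.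
  have az2 := adj_contract_end nT aF cF fac hk za zc hz.
  have yz2 := adj_contract_neq2 nT aF cF fac yc zc yz.
  have [h' [hac' h'yz]] := contract3_at pT nac (flat_face f2 az2 yz2).
  have h'E : h' = k.
    have : h' = h \/ h' = k by case: hk hac' => -[-> ->] []; auto.
    by case=> // E; rewrite -E h'yz in hyz.
  subst h'; have [ky kz _] := face_adj pT h'yz.
  have kh := ends_sym hk.
  have [_ fky _] := deg3 nT aF cF fac kh ya yc za zc h'yz hy hz.
  by exists k; rewrite (ends_merge fac kh).
have xy2 := flat_adj fxy; have [xc yc] := adj_contract_neq nac xy2.
case: (eqVneq x a) => xa.
  rewrite xa in fxy; have [h [mh fhy]] := at_end y fxy.
  by apply: lift fhy _ _; rewrite ?xa // merge_neq.
case: (eqVneq y a) => ya.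
  rewrite ya flatC in fxy; have [h [mh fhy]] := at_end x fxy.
  by rewrite flatC in fhy; apply: lift fhy _ _; rewrite ?ya // merge_neq.
case f: (flat T x y); first by apply: lift f _ _; rewrite merge_neq.
have [h [k [hk hxy kx ky]]] := off x y xy2 xa ya fxy (negbT f).
have [nbr fhx _] := deg3 nT aF cF fac hk xa xc ya yc hxy kx ky.
have hF := ends_Fr aF cF hk.
have [|i [p [q [uvpq on]]]] := PT h x fhx.
  by apply: contraNN hF => /FrE_Fr.
have hpq : h = p \/ h = q.
  by apply: (on_lazy_path_inner on); apply: contraNneq hF => ->.
have xy := adj_contract_off pT nac xa ya xy2.
have [p' [q' pq']] :=
  deg3_lazy_path nT aF cF fac hk xa xc ya yc kx ky xy nbr (uF i) (vF i) (uv i) uvpq hpq.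
by exists i, p', q'.
Qed.

Lemma vertices_on_paths_contract : vertices_on_paths T -> vertices_on_paths T2.
Proof.
move=> QT x xT2 xF f2.
have [y0 [z0 xyz0]] := vertexP pT2 xT2.
have [xy0 xz0 _] := face_adj pT2 xyz0.
have xc : x != c by case: (adj_contract_neq nac xy0).
have lift x' : x' \in vertices T -> x' \notin Fr -> m x' = x ->
    (forall y, adj T x' y -> flat T x' y) ->
    exists i j, [/\ i != j, on_path T2 i x & on_path T2 j x].
  move=> x'T x'F xE f; have [i [j [ij oi oj]]] := QT x' x'T x'F f.
  have img k : on_path T k x' -> on_path T2 k x.
    move=> [p [q [uvpq on]]]; exists (m p), (m q); rewrite (lazy_path_contract nT) //.
    by split=> //; rewrite -xE; case: on => ->; auto.
  by exists i, j; split=> //; apply: img.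
case: (boolP [forall y, adj T x y ==> flat T x y]) => [/forallP f|].
  apply: (lift x) => //; last by move=> y xy; have := f y; rewrite xy.
    case: (eqVneq x a) => xa; first by rewrite xa (adj_vertex ac).
    have [x' [y' [z' [x'E _ _ xyz']]]] := contract3 pT nac xyz0.
    by rewrite -(merge_eq xa x'E) (face_vertex xyz') // !inE eqxx.
  exact: merge_neq.
case/forallPn=> y; rewrite negb_imply => /andP[xy nf].
have [z [xz yz xyz]] := flatPn xy nf.
case: (eqVneq x a) => [xa|xa].
  subst x; have fc := ends_flat fac (or_introl (conj erefl erefl)).
  have zc : z != c.
    by apply: contraNneq xyz => E; subst z; rewrite set3AC (flat_face fac) // adj_sym.
  have yc : y != c by apply: contraNneq nf => ->.
  have ya : y != a by rewrite eq_sym (adj_neq xy).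
  have za : z != a by rewrite eq_sym (adj_neq xz).
  have hk : ends a c a c by left.
  have ay2 := adj_contract_end nT aF cF fac hk ya yc xy.
  have az2 := adj_contract_end nT aF cF fac hk za zc xz.
  have yz2 := adj_contract_neq2 nT aF cF fac yc zc yz.
  have [h [[] hE hyz]] := contract3_at pT nac (flat_face (f2 y ay2) az2 yz2).
    by rewrite -hE hyz in xyz.
  subst h; have kh := ends_sym hk.
  have [_ _ fc'] := deg3 nT aF cF fac kh ya yc za zc hyz xy xz.
  by apply: (lift c) => //; rewrite ?merge_r // (adj_vertex (y := a)) // adj_sym.
have [k [t [kac xk xt kt xkt]]] : exists k t,
    [/\ k = a \/ k = c, adj T x k, adj T x t, adj T k t & [set x; k; t] \notin T].
  case: (boolP ((y == a) || (y == c))) => [/orP yac|].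
    by exists y, z; split=> //; case: yac => /eqP; auto.
  rewrite negb_or => /andP[ya yc].
  case: (boolP ((z == a) || (z == c))) => [/orP zac|].
    exists z, y; split=> //; first by case: zac => /eqP; auto.
      by rewrite adj_sym.
    by rewrite set3AC.
  rewrite negb_or => /andP[za zc]; case/negP: xyz.
  apply: (contract3_off pT nac (a := a) (c := c)) => //.
  by apply: flat_face; [apply: f2| |]; apply: (adj_contract_neq2 nT aF cF fac).
have [h kh] := ends_of kac; have hk := ends_sym kh.
have th : t != h.
  apply: contraNneq xkt => E; subst t; rewrite set3_rot.
  by rewrite (flat_face (ends_flat fac kh)) // adj_sym.
have tk : t != k by rewrite eq_sym (adj_neq kt).
have [ta tc] : t != a /\ t != c by case: kh th tk => -[-> ->] *.
have xt2 := adj_contract_neq2 nT aF cF fac xc tc xt.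
rewrite adj_sym in xk.
have ax2 := adj_contract_end nT aF cF fac kh xa xc xk; rewrite adj_sym in ax2.
have at2 := adj_contract_end nT aF cF fac kh ta tc kt; rewrite adj_sym in at2.
have xta2 := flat_face (f2 t xt2) ax2 at2; rewrite -set3_rot in xta2.
have [h' [hac hxt]] := contract3_at pT nac xta2.
have h'E : h' = h.
  have : h' = h \/ h' = k by case: kh hac => -[-> ->] []; auto.
  by case=> // E; rewrite set3C -E hxt in xkt.
subst h'; have [nbr _ fh] := deg3 nT aF cF fac hk xa xc ta tc hxt xk kt.
have hF := ends_Fr aF cF hk; have [hx _ _] := face_adj pT hxt.
have [i [j [ij oi oj]]] := QT h (adj_vertex hx) hF fh.
have img l : on_path T l h -> on_path T2 l x.
  case=> p [q [uvpq hpq]]; have [p' [q' [pq' on]]] :=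
    deg3_lazy_path nT aF cF fac hk xa xc ta tc xk kt xt nbr (uF l) (vF l) (uv l) uvpq hpq.
  exists p', q'; split=> //.
  by apply: (on_lazy_path_inner on); apply: contraNneq xF => ->.
by exists i, j; split=> //; apply: img.
Qed.

End ShortPathProperties.

Lemma ord3_ind (P : 'I_3 -> Prop) : P 0%R -> P 1%R -> P 2%R -> forall i, P i.
Proof.
move=> P0 P1 P2 [[|[|[|//]]] i3].
- by rewrite (_ : Ordinal i3 = 0%R) //; apply: val_inj.
- by rewrite (_ : Ordinal i3 = 1%R) //; apply: val_inj.
- by rewrite (_ : Ordinal i3 = 2%R) //; apply: val_inj.
Qed.

Lemma ord3_next (i j : 'I_3) : i != j -> j = (i + 1)%R \/ i = (j + 1)%R.
Proof.
elim/ord3_ind: i; elim/ord3_ind: j => // _;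
  by [left; apply/eqP|right; apply/eqP].
Qed.

Lemma ord3_next_asym (i j : 'I_3) : j = (i + 1)%R -> i = (j + 1)%R -> False.
Proof. by move=> /eqP + /eqP; elim/ord3_ind: i; elim/ord3_ind: j. Qed.

Lemma ord3_succ : ((0 + 1)%R = 1%R :> 'I_3) * ((1 + 1)%R = 2%R :> 'I_3) *
  ((2 + 1)%R = 0%R :> 'I_3).
Proof. by do !split; apply: val_inj. Qed.

Section PreIrreducible.
Variables (V : finType) (T : {set {set V}}) (w : 'I_3 -> V).
Variable side : 'I_3 -> {set V} -> bool.
Hypotheses (TT : triangulation T) (wT : three_cycle T w) (cs : cut_sides T w side).
Implicit Types (f g : {set V}) (F : {set cut_vertex V}) (i j k : 'I_3) (s r : bool).
Implicit Types (X Y Z : V) (x y z p q : cut_vertex V).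
Local Notation T0 := (pre_irreducible T w side).
Local Notation Fr := (frame_vertices T w).
Local Notation cap := (cap_faces T w).
Local Notation corner := (cut_corner w side).
Local Notation bnd := (bnd V).

Let pT : pure T := tri_face TT.

Definition on_cycle X : bool := [exists i, w i == X].

Definition proj x : V :=
  match x with
  | Some (inl X) => X
  | Some (inr (i, _)) => w i
  | None => w 0%R
  end.

Definition twist i : bool := one_sided T w && (i == 2%R).

Lemma w_inj : injective w.
Proof.
move=> i j E; apply/eqP; case: eqVneq => // /ord3_next[] ij.
  by have := adj_neq (wT i); rewrite E ij eqxx.
by have := adj_neq (wT j); rewrite -E ij eqxx.
Qed.

Lemma on_cycleP X : reflect (exists i, X = w i) (on_cycle X).
Proof. by apply: (iffP existsP) => -[i]; [move/eqP<-|move->]; exists i. Qed.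

Lemma cycle_edge i j : i != j -> [set w i; w j] \in cycle_edges w.
Proof.
case/ord3_next=> ->; apply/imsetP; first by exists i.
by exists j; rewrite // setUC.
Qed.

Lemma cycle_edge_on X Y : [set X; Y] \in cycle_edges w -> on_cycle X && on_cycle Y.
Proof.
case/imsetP=> i _ E.
have on t : t \in [set X; Y] -> on_cycle t.
  by rewrite E !inE => /orP[]/eqP->; apply/on_cycleP; eexists.
by rewrite !on ?set21 ?set22.
Qed.

Lemma corner_on f i : corner f (w i) = bnd i (side i f).
Proof.
by rewrite /cut_corner; case: pickP => [j /eqP/w_inj->|/(_ i)] //; rewrite eqxx.
Qed.

Lemma corner_off f X : ~~ on_cycle X -> corner f X = old X.
Proof.
rewrite /cut_corner; case: pickP => // i /eqP wX /negP[].
by apply/on_cycleP; exists i.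
Qed.

Lemma proj_corner f X : proj (corner f X) = X.
Proof.
case: (boolP (on_cycle X)) => [/on_cycleP[i ->]|oX]; first by rewrite corner_on.
by rewrite corner_off.
Qed.

Lemma corner_inj f : injective (corner f).
Proof. exact: can_inj (proj_corner f). Qed.

Lemma proj_cut_face f : proj @: cut_face w side f = f.
Proof.
rewrite -imset_comp -[RHS]imset_id.
by apply: eq_imset => X /=; rewrite proj_corner.
Qed.

Lemma cut_face3 f X Y Z : f = [set X; Y; Z] ->
  cut_face w side f = [set corner f X; corner f Y; corner f Z].
Proof. by move=> fE; rewrite /cut_face {2}fE !imsetU !imset_set1. Qed.

Lemma corner_proj f x : x \in cut_face w side f -> proj x \in f /\ corner f (proj x) = x.
Proof. by case/imsetP=> X Xf ->; rewrite proj_corner. Qed.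

Lemma cut_face_proj3 f x y z : [set x; y; z] = cut_face w side f ->
  f = [set proj x; proj y; proj z].
Proof. by move=> E; rewrite -(proj_cut_face f) -E !imsetU !imset_set1. Qed.

Lemma cut_face_T0 f : f \in T -> cut_face w side f \in T0.
Proof. by move=> fT; rewrite inE imset_f. Qed.

Lemma capP F : F \in cap ->
  (one_sided T w /\ exists i s, F = [set t' V; bnd i s; bnd (i + 1)%R (s (+) (i == 2%R))])
  \/ (~~ one_sided T w /\ exists s, F = [set bnd 0%R s; bnd 1%R s; bnd 2%R s]).
Proof.
rewrite /cap_faces; case: ifP => os; rewrite !inE => FT; [left|right]; split=> //.
  case/or4P: FT => [||| /or3P[]] /eqP->.
  - by exists 0%R, true; rewrite ord3_succ.
  - by exists 1%R, true; rewrite ord3_succ.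
  - by exists 2%R, true; rewrite ord3_succ.
  - by exists 0%R, false; rewrite ord3_succ.
  - by exists 1%R, false; rewrite ord3_succ.
  - by exists 2%R, false; rewrite ord3_succ.
by case/orP: FT => /eqP->; [exists true|exists false].
Qed.

Lemma cap_one i s : one_sided T w ->
  [set t' V; bnd i s; bnd (i + 1)%R (s (+) (i == 2%R))] \in cap.
Proof.
rewrite /cap_faces => ->; rewrite inE !in_cons.
by case: s; elim/ord3_ind: i; rewrite ord3_succ /u' /v' /= ?eqxx ?orbT.
Qed.

Lemma cap_two s : ~~ one_sided T w -> [set bnd 0%R s; bnd 1%R s; bnd 2%R s] \in cap.
Proof. by rewrite /cap_faces => /negPf->; rewrite !inE; case: s; rewrite eqxx ?orbT. Qed.

Lemma bnd_eq i j s r : (bnd i s == bnd j r) = (i == j) && (s == r).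
Proof. by []. Qed.

Lemma cap_pure F : F \in cap -> #|F| = 3.
Proof.
case/capP=> [[_ [i [s ->]]]|[_ [s ->]]]; apply/eqP; rewrite cards3 ?bnd_eq //.
by elim/ord3_ind: i.
Qed.

Lemma cap_not_old F X : F \in cap -> old X \notin F.
Proof. by case/capP=> [[_ [i [s ->]]]|[_ [s ->]]]; rewrite !inE. Qed.

Lemma cap_twist F i s r : F \in cap -> bnd i s \in F -> bnd (i + 1)%R r \in F ->
  r = s (+) twist i.
Proof.
rewrite /twist; case/capP=> [[-> [j [s' ->]]]|[/negPf-> [s' ->]]];
  rewrite !inE !bnd_eq /=.
  by elim/ord3_ind: i; elim/ord3_ind: j => //=; case: s; case: r; case: s'.
by elim/ord3_ind: i => //=; case: s; case: r; case: s'.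
Qed.

Lemma cap_same F i s r : F \in cap -> bnd i s \in F -> bnd i r \in F -> r = s.
Proof.
case/capP=> [[_ [j [s' ->]]]|[_ [s' ->]]]; rewrite !inE !bnd_eq /=.
  by elim/ord3_ind: i; elim/ord3_ind: j => //=; case: s; case: r; case: s'.
by elim/ord3_ind: i => //=; case: s; case: r; case: s'.
Qed.

Lemma cap_edge i s : exists F,
  [/\ F \in cap, bnd i s \in F & bnd (i + 1)%R (s (+) twist i) \in F].
Proof.
rewrite /twist; case: (boolP (one_sided T w)) => os /=.
  by exists [set t' V; bnd i s; bnd (i + 1)%R (s (+) (i == 2%R))];
     rewrite cap_one // !inE !eqxx !orbT.
exists [set bnd 0%R s; bnd 1%R s; bnd 2%R s]; rewrite cap_two // !inE !bnd_eq addbF eqxx.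
by elim/ord3_ind: i.
Qed.

Lemma bnd_Fr i s : bnd i s \in Fr.
Proof. by have [F [FT xF _]] := cap_edge i s; apply: face_vertex FT xF. Qed.

Lemma old_Fr X : old X \notin Fr.
Proof. by apply/bigcupP=> -[F FT]; apply/negP/cap_not_old. Qed.

Lemma frame_edge_Fr x y : [set x; y] \in frame_edges T w -> x \in Fr.
Proof. by move/adj_vertex. Qed.

Lemma T0P F : F \in T0 -> (exists2 f, f \in T & F = cut_face w side f) \/ F \in cap.
Proof. by rewrite inE => /orP[/imsetP|]; auto. Qed.

Lemma T0_pure : pure T0.
Proof.
move=> F /T0P[[f fT ->]|/cap_pure//].
by rewrite card_imset ?pT //; apply: corner_inj.
Qed.

Lemma interior_face F x : F \in T0 -> x \in F -> x \notin Fr -> exists f X,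
  [/\ f \in T, F = cut_face w side f, X \in f, ~~ on_cycle X & x = old X].
Proof.
move=> /T0P[[f fT ->] /imsetP[X Xf ->]|FT xF]; last by rewrite (face_vertex FT).
case: (boolP (on_cycle X)) => [/on_cycleP[i ->]|oX xF].
  by rewrite corner_on bnd_Fr.
by exists f, X; rewrite corner_off.
Qed.

Lemma face_meet f g X Y : f \in T -> g \in T -> f != g -> X != Y ->
  X \in f -> Y \in f -> X \in g -> Y \in g -> f :&: g = [set X; Y].
Proof.
move=> fT gT fg XY Xf Yf Xg Yg; apply/eqP; rewrite eq_sym eqEcard cards2 XY.
rewrite subUset !sub1set !inE Xf Yf Xg Yg /= -ltnS -(pT fT).
apply: proper_card; rewrite properE subsetIl /= subsetI subxx /=.
by apply: contra fg => sfg; rewrite eqEcard sfg !pT.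
Qed.

Lemma corner_eq f g X Y : f \in T -> g \in T -> X != Y ->
  X \in f -> Y \in f -> X \in g -> Y \in g -> ~~ (on_cycle X && on_cycle Y) ->
  corner f X = corner g X.
Proof.
move=> fT gT XY Xf Yf Xg Yg oXY; case: (eqVneq f g) => [->//|fg].
case: (boolP (on_cycle X)) => [/on_cycleP[i XE]|oX]; last by rewrite !corner_off.
have E := face_meet fT gT fg XY Xf Yf Xg Yg.
have := cs.1 i f g fT gT; rewrite E XE !corner_on -XE => ->.
- by rewrite (negPf (contra (@cycle_edge_on X Y) oXY)) addbF.
- exact: adjI fT Xf Yf XY.
- by rewrite !inE eqxx.
Qed.

Lemma side_switch f g i j : f \in T -> g \in T -> f != g -> i != j ->
  w i \in f -> w j \in f -> w i \in g -> w j \in g -> side i f = ~~ side i g.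
Proof.
move=> fT gT fg ij wif wjf wig wjg.
have wij : w i != w j by apply: contraNneq ij => /w_inj->.
have E := face_meet fT gT fg wij wif wjf wig wjg.
have := cs.1 i f g fT gT; rewrite E cycle_edge // addbT; apply.
  exact: adjI fT wif wjf wij.
by rewrite !inE eqxx.
Qed.

Lemma side_next f i : f \in T -> w i \in f -> w (i + 1)%R \in f ->
  side (i + 1)%R f = side i f (+) twist i.
Proof. exact: cs.2. Qed.

Lemma adj_cut f X Y : f \in T -> X \in f -> Y \in f -> X != Y ->
  adj T0 (corner f X) (corner f Y).
Proof.
move=> fT Xf Yf XY; apply: (adjI (cut_face_T0 fT)); rewrite ?imset_f //.
by rewrite (inj_eq (@corner_inj f)).
Qed.

Lemma adj_other_face f X Y : f \in T -> X \in f -> Y \in f -> X != Y ->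
  exists g, [/\ g \in T, g != f, X \in g & Y \in g].
Proof.
move=> fT Xf Yf XY; have [p [q [pq Xp Xq _]]] := tri_two_faces TT (adjI fT Xf Yf XY).
case: (eqVneq [set X; Y; p] f) => [E|]; last by exists [set X; Y; p]; rewrite !inE !eqxx orbT.
exists [set X; Y; q]; rewrite !inE !eqxx orbT Xq; split=> //.
rewrite -E; apply: contraNneq pq => /third_inj->//; first by case: (face_neq pT Xq).
by case: (face_neq pT Xq).
Qed.

Lemma pre_irreducible_near : near_triangulation Fr T0.
Proof.
split; first exact: T0_pure.
- move=> x y xy xF; have [nxy [F [FT xF' yF']]] := adj_face xy.
  have [f [X [fT FE Xf oX xE]]] := interior_face FT xF' xF.
  have [Y Yf yE] : exists2 Y, Y \in f & y = corner f Y.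
    by move: yF'; rewrite FE => /imsetP.
  have xE' h : x = corner h X by rewrite corner_off.
  have XY : X != Y by apply: contraNneq nxy => E; rewrite yE -E -xE'.
  have [g [gT gf Xg Yg]] := adj_other_face fT Xf Yf XY.
  have [P fE] := card3_third (pT fT) Xf Yf XY.
  have [Q gE] := card3_third (pT gT) Xg Yg XY.
  have yE' : y = corner g Y.
    rewrite yE; apply: (corner_eq fT gT (Y := X)); rewrite // 1?eq_sym //.
    by rewrite (negPf oX) andbF.
  exists (corner f P), (corner g Q); split.
  + apply: contraNneq gf => /(congr1 proj); rewrite !proj_corner => PQ.
    by rewrite fE gE PQ.
  + by rewrite yE (xE' f) -(cut_face3 fE) cut_face_T0.
  + by rewrite yE' (xE' g) -(cut_face3 gE) cut_face_T0.
- move=> a c z p r aF cF ac azp czp rzp.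
  have in3 x y t : [/\ x \in [set x; y; t], y \in [set x; y; t] & t \in [set x; y; t]].
    by rewrite !inE !eqxx !orbT.
  have [ain zin pin] := in3 a z p; have [cin zin' pin'] := in3 c z p.
  have [f [A [fT fE Af oA aE]]] := interior_face azp ain aF.
  have [g [C [gT gE Cg oC cE]]] := interior_face czp cin cF.
  have f3 := cut_face_proj3 fE; have g3 := cut_face_proj3 gE.
  rewrite fE in zin pin; rewrite gE in zin' pin'.
  have [[zf zfE] [pf pfE]] := (corner_proj zin, corner_proj pin).
  have [[zg zgE] [pg pgE]] := (corner_proj zin', corner_proj pin').
  have AC : A != C by apply: contraNneq ac; rewrite aE cE => ->.
  have fT' := fT; have gT' := gT; rewrite f3 aE /= in fT'; rewrite g3 cE /= in gT'.
  have [AZ AP ZP] := face_neq pT fT'.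
  have fg : f != g.
    apply: contraNneq AC => E; move: g3; rewrite cE -E f3 aE /=.
    by rewrite [LHS]set3_rot [RHS]set3_rot => /third_inj->; rewrite // eq_sym.
  have offZP : ~~ (on_cycle (proj z) && on_cycle (proj p)).
    apply/negP=> /andP[/on_cycleP[i zi] /on_cycleP[j pj]].
    have ij : i != j by apply: contraNneq ZP; rewrite zi pj => ->.
    rewrite zi in zf zg zfE zgE; rewrite pj in pf pg.
    have := side_switch fT gT fg ij zf pf zg pg.
    by move: zfE; rewrite -zgE !corner_on => -[->]; case: (side i g).
  have [] := T0P rzp; last first.
    move=> rzpC; case/negP: offZP; have [_ zr pr] := in3 r z p.
    apply/andP; split; apply: contraT => oX.
      by have := cap_not_old (proj z) rzpC; rewrite -(corner_off f oX) zfE zr.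
    by have := cap_not_old (proj p) rzpC; rewrite -(corner_off f oX) pfE pr.
  case=> h hT hE; have h3 := cut_face_proj3 hE.
  have [rin _ _] := in3 r z p; rewrite hE in rin; have [_ rhE] := corner_proj rin.
  have hT' := hT; rewrite h3 in hT'.
  rewrite set3_rot in fT'; rewrite set3_rot in gT'; rewrite set3_rot in hT'.
  have [zp _ _] := face_adj pT fT'.
  have [b [d [bd _ _ all]]] := tri_two_faces TT zp.
  have [rE|rE] : proj r = A \/ proj r = C.
    by move: AC; case: (all _ fT') => ->; case: (all _ gT') => ->;
     case: (all _ hT') => ->; rewrite ?eqxx //; auto.
  + by left; rewrite -rhE rE corner_off.
  + by right; rewrite -rhE rE corner_off.
- move=> c x y z cF cxy cxz cyz t ct.
  have [_ [F [FT cin tin]]] := adj_face ct.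
  have in1 y' z' : c \in [set c; y'; z'] by rewrite !inE eqxx.
  have [f [C [fT fE Cf oC cE]]] := interior_face FT cin cF.
  have [f1 [_ [f1T f1E _ _ _]]] := interior_face cxy (in1 _ _) cF.
  have [f2 [_ [f2T f2E _ _ _]]] := interior_face cxz (in1 _ _) cF.
  have [f3 [_ [f3T f3E _ _ _]]] := interior_face cyz (in1 _ _) cF.
  have pc : proj c = C by rewrite cE.
  have face g x' y' : g \in T -> [set c; x'; y'] = cut_face w side g ->
      [set C; proj x'; proj y'] \in T.
    by move=> gT gE; rewrite -pc -(cut_face_proj3 gE).
  rewrite fE in tin; have [tf tE] := corner_proj tin.
  have Ct : C != proj t.
    apply: contraTneq ct => E; apply: contraTN isT => /adj_neq/eqP[].
    by rewrite -tE -E corner_off.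
  have same g x' : g \in T -> x' \in cut_face w side g -> c \in cut_face w side g ->
      proj t = proj x' -> t = x'.
    move=> gT x'g cg E; have [x'g' <-] := corner_proj x'g; rewrite -tE -E.
    have [cg' _] := corner_proj cg; rewrite pc in cg'; rewrite -E in x'g'.
    apply: (corner_eq fT gT (Y := C)); rewrite // 1?eq_sym //.
    by rewrite (negPf oC) andbF.
  have := tri_deg3 TT (face _ _ _ f1T f1E) (face _ _ _ f2T f2E) (face _ _ _ f3T f3E)
     (adjI fT Cf tf Ct).
  rewrite !inE -!orbA => /or3P[]/eqP E.
  + by rewrite (same f1 x) ?eqxx // -f1E !inE eqxx ?orbT.
  + by rewrite (same f1 y) ?eqxx ?orbT // -f1E !inE eqxx ?orbT.
  + by rewrite (same f2 z) ?eqxx ?orbT // -f2E !inE eqxx ?orbT.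
Qed.

Definition lifts x X : Prop :=
  (~~ on_cycle X /\ x = old X) \/ exists i s, X = w i /\ x = bnd i s.

Lemma corner_lifts f X : lifts (corner f X) X.
Proof.
case: (boolP (on_cycle X)) => [/on_cycleP[i ->]|oX].
  by right; exists i, (side i f); rewrite corner_on.
by left; rewrite corner_off.
Qed.

Lemma lifts_cases x y X : lifts x X -> lifts y X ->
  x = y \/ exists i s, [/\ X = w i, x = bnd i s & y = bnd i (~~ s)].
Proof.
case=> [[oX ->]|[i [s [XE ->]]]]; case=> [[oX' ->]|[j [r [XE' ->]]]]; first by left.
- by case/on_cycleP: oX; exists j.
- by case/on_cycleP: oX'; exists i.
move: XE'; rewrite XE => /w_inj <-; case: (eqVneq s r) => [->|sr]; first by left.
by right; exists i, s; split=> //; case: s r sr => -[].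
Qed.

Lemma adj_lifts x z X Z : lifts x X -> lifts z Z -> adj T X Z ->
  [\/ adj T0 x z,
      exists i s, [/\ X = w i, x = bnd i s & adj T0 (bnd i (~~ s)) z] |
      exists k s, [/\ Z = w k, z = bnd k s & adj T0 x (bnd k (~~ s))]].
Proof.
move=> xX zZ /adj_face[XZ [g [gT Xg Zg]]].
have fin h : h \in T -> X \in h -> Z \in h -> corner h X = x -> 
    adj T0 x z \/ exists k s, [/\ Z = w k, z = bnd k s & adj T0 x (bnd k (~~ s))].
  move=> hT Xh Zh hX; have := adj_cut hT Xh Zh XZ; rewrite hX.
  case: (lifts_cases zZ (corner_lifts h Z)) => [<-|[k [s [ZE zE ->]]]]; first by left.
  by right; exists k, s.
have fin' h : h \in T -> X \in h -> Z \in h -> corner h X = x -> 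
  [\/ adj T0 x z,
      exists i s, [/\ X = w i, x = bnd i s & adj T0 (bnd i (~~ s)) z] |
      exists k s, [/\ Z = w k, z = bnd k s & adj T0 x (bnd k (~~ s))]].
  move=> hT Xh Zh hX.
  by case: (fin h hT Xh Zh hX); [constructor 1|constructor 3].
case: (lifts_cases xX (corner_lifts g X)) => [/esym|[i [s [XE xE gE]]]]; first exact: fin'.
case: (boolP (on_cycle Z)) => [/on_cycleP[j ZE]|oZ]; last first.
  constructor 2; exists i, s; split=> //; rewrite -gE.
  case: zZ => [[_ ->]|[k [r [ZE _]]]]; last by case/on_cycleP: oZ; exists k.
  by rewrite -(corner_off g oZ) adj_cut.
have [h [hT hg Xh Zh]] := adj_other_face gT Xg Zg XZ.
apply: (fin' h) => //; rewrite XE xE corner_on.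
have ij : i != j by apply: contraNneq XZ; rewrite XE ZE => ->.
rewrite (side_switch hT gT hg ij) -?XE -?ZE //.
by move: gE; rewrite XE corner_on => -[->]; rewrite negbK.
Qed.

Let u := u' V.
Let v := v' V.

Lemma lazy_path_sides i s p q : p != bnd i (~~ s) -> q != bnd i s ->
  adj T0 (bnd i s) p -> adj T0 p q -> adj T0 q (bnd i (~~ s)) ->
  exists p' q', lazy_path T0 (u i) (v i) p' q' /\
    forall x y, on_lazy_path (bnd i s) (bnd i (~~ s)) p q x y ->
      on_lazy_path (u i) (v i) p' q' x y.
Proof.
move=> pn qn sp pq qs.
have path : lazy_path T0 (bnd i s) (bnd i (~~ s)) p q.
  by rewrite /lazy_path pn qn /eq_or_adj sp pq qs !orbT.
case: s path {pn qn sp qs} => path; first by exists p, q.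
exists q, p; split; first by rewrite lazy_path_rev.
by move=> x y; rewrite on_lazy_path_rev.
Qed.

Lemma adj_cut_edge x y : adj T0 x y -> [set x; y] \notin frame_edges T w ->
  exists f X Y, [/\ f \in T, X \in f, Y \in f, X != Y &
    [/\ x = corner f X, y = corner f Y & ~~ (on_cycle X && on_cycle Y)]].
Proof.
move=> xy xyE; have [nxy [F [FT xF yF]]] := adj_face xy.
have [[f fT FE]|FC] := T0P FT; last by case/negP: xyE; apply: adjI FC xF yF nxy.
rewrite FE in xF yF; have [[Xf xE] [Yf yE]] := (corner_proj xF, corner_proj yF).
have XY : proj x != proj y by apply: contraNneq nxy => E; rewrite -xE -yE E.
exists f, (proj x), (proj y); split=> //; split=> //.
apply: contraNN xyE => /andP[/on_cycleP[i Xi] /on_cycleP[j Yj]].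
have ij : i != j by apply: contraNneq XY; rewrite Xi Yj => ->.
have cap_adj k : w k \in f -> w (k + 1)%R \in f ->
    [set corner f (w k); corner f (w (k + 1)%R)] \in frame_edges T w.
  move=> kf kf'; rewrite !corner_on side_next //.
  have [F' [F'C k1 k2]] := cap_edge k (side k f); apply: adjI F'C k1 k2 _.
  by rewrite bnd_eq; elim/ord3_ind: (k).
rewrite -xE -yE Xi Yj; rewrite Xi in Xf; rewrite Yj in Yf.
by case/ord3_next: ij => E; subst; rewrite 1?cap_adj // setUC cap_adj.
Qed.

Hypothesis nonflat : forall X Y, adj T X Y -> ~~ flat T X Y.

Lemma pre_irreducible_edges : edges_on_paths (frame_edges T w) u v T0.
Proof.
have main f X Y x y : f \in T -> X \in f -> Y \in f -> X != Y ->
    x = corner f X -> y = corner f Y -> ~~ on_cycle Y -> flat T0 x y ->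
    exists i p q, lazy_path T0 (u i) (v i) p q /\ on_lazy_path (u i) (v i) p q x y.
  move=> fT Xf Yf XY xE yE oY fxy.
  have XYadj := adjI fT Xf Yf XY; have xy := flat_adj fxy.
  have [Z [XZ YZ XYZ]] := flatPn XYadj (nonflat XYadj).
  have [nYZ [h [hT Yh Zh]]] := adj_face YZ.
  have yE' : y = old Y by rewrite yE corner_off.
  have yn i s : y != bnd i s by rewrite yE'.
  pose z := corner h Z.
  have yz : adj T0 y z by rewrite yE' -(corner_off h oY) adj_cut.
  have same x' X' : lifts x' X' -> proj x' = X'.
    by case=> [[_ ->]|[i [s [-> ->]]]].
  have xX : lifts x X by rewrite xE; apply: corner_lifts.
  have zZ : lifts z Z by apply: corner_lifts.
  have zx := adj_neq XZ.
  case: (adj_lifts xX zZ XZ) => [xz|[i [s [XE xiE xz]]]|[k [s [ZE zkE xz]]]].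
  - have xyz := flat_face fxy xz yz.
    have [||g [_ [gT gE _ _ _]]] := interior_face (x := y) xyz.
    + by rewrite !inE eqxx orbT.
    + by rewrite yE' old_Fr.
    have := cut_face_proj3 gE; rewrite (same _ _ xX) (same _ _ zZ) yE' /= => gE'.
    by rewrite -gE' gT in XYZ.
  - have [||||| p [q [path on]]] := @lazy_path_sides i s y z => //.
    + by apply: contraNneq zx => E; rewrite -(same _ _ zZ) E XE.
    + by rewrite -xiE.
    + by rewrite adj_sym.
    exists i, p, q; split=> //; apply: on.
    by rewrite -xiE /on_lazy_path /same_edge !eqxx.
  - have [||||| p [q [path on]]] := @lazy_path_sides k s y x => //.
    + by apply: contraNneq zx => E; rewrite -(same _ _ xX) E ZE.
    + by rewrite -zkE adj_sym.
    + by rewrite adj_sym.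
    exists k, p, q; split=> //; apply: on.
    by rewrite -zkE /on_lazy_path /same_edge !eqxx !orbT.
move=> x y fxy xyE.
have [f [X [Y [fT Xf Yf XY [xE yE oXY]]]]] := adj_cut_edge (flat_adj fxy) xyE.
move: oXY; rewrite negb_and => /orP[oX|oY]; last exact: (main f X Y).
rewrite flatC in fxy; rewrite eq_sym in XY.
have [i [p [q [path on]]]] := main f Y X y x fT Yf Xf XY yE xE oX fxy.
by exists i, p, q; rewrite on_lazy_pathC.
Qed.

Lemma adj_bnd p i s : p != t' V -> adj T0 p (bnd i s) ->
  (exists X f, [/\ f \in T, X \in f, w i \in f, X != w i &
      [/\ ~~ on_cycle X, p = old X & s = side i f]]) \/
  (exists k r, p = bnd k r /\
     ((k = (i + 1)%R /\ r = s (+) twist i) \/ (i = (k + 1)%R /\ s = r (+) twist k))).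
Proof.
move=> pt /adj_face[ps [F [FT pF sF]]].
have bb k r : k != i -> bnd k r \in F ->
   (k = (i + 1)%R /\ r = s (+) twist i) \/ (i = (k + 1)%R /\ s = r (+) twist k).
  move=> ki; have [[f fT FE]|FC] := T0P FT.
    rewrite FE in sF *; move=> rF.
    have [[/= wif sE] [/= wkf rE]] := (corner_proj sF, corner_proj rF).
    move: sE rE; rewrite /= !corner_on => -[<-] [<-].
    by case/ord3_next: ki => E; [right|left]; subst; rewrite side_next.
  move=> rF; case/ord3_next: ki => E; [right|left]; split=> //; subst.
    exact: cap_twist FC rF sF.
  exact: cap_twist FC sF rF.
case: p pt ps pF => [[X|[k r]]|] pt ps pF //.
  left; have [f [X' [fT FE Xf oX [XE]]]] := interior_face FT pF (old_Fr X); subst X'.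
  rewrite FE in sF; have [/= wif sE] := corner_proj sF.
  exists X, f; split=> //.
    by apply: contraNneq oX => ->; apply/on_cycleP; exists i.
  by split=> //; move: sE; rewrite /= corner_on => -[].
right; exists k, r; split=> //; apply: (bb _ _ _ pF).
apply: contraNneq ps => ki; subst k.
have [[f fT FE]|FC] := T0P FT; last by rewrite (cap_same FC sF pF).
rewrite FE in sF pF; have [[_ sE] [_ pE]] := (corner_proj sF, corner_proj pF).
by rewrite -sE -[Some _]pE.
Qed.

Lemma adj_one_side p i : p != t' V -> adj T0 p (u i) -> adj T0 p (v i) -> False.
Proof.
move=> pt pu pv; case: (adj_bnd pt pu) (adj_bnd pt pv).
  move=> [X [f [fT Xf wf Xw [oX pE sf]]]] [|[k [r [pE' _]]]]; last by rewrite pE in pE'.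
  move=> [X' [g [gT Xg wg Xw' [oX' pE' sg]]]]; have XE : X' = X by rewrite pE in pE'; case: pE'.
  subst X'; rewrite eq_sym in Xw.
  have := corner_eq fT gT Xw wf Xf wg Xg.
  by rewrite (negPf oX) andbF !corner_on -sf -sg => /(_ isT).
move=> [k [r [pE H]]] [[X [f [_ _ _ _ [_ pE' _]]]]|[k' [r' [pE' H']]]].
  by rewrite pE in pE'.
rewrite pE in pE'; case: pE' => kE rE; subst k' r'; move: H H'.
case=> -[E1 E2] [] -[E1' E2'].
- by move: E2; rewrite E2'; case: (twist i).
- exact: ord3_next_asym E1 E1'.
- exact: ord3_next_asym E1 E1'.
- by move: E2'; rewrite -E2.
Qed.

Lemma pre_irreducible_vertices : vertices_on_paths Fr u v T0.
Proof.
move=> x xT0 xF fx.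
have xn i s : x != bnd i s by apply: contraNneq xF => ->; apply: bnd_Fr.
have xE y : [set x; y] \notin frame_edges T w by apply: contraNN xF => /frame_edge_Fr.
have [y [z xyz]] := vertexP T0_pure xT0; have [xy _ _] := face_adj T0_pure xyz.
have [i [p [q [path on]]]] := pre_irreducible_edges (fx y xy) (xE y).
have xpq : x = p \/ x = q by exact: (on_lazy_path_inner on (xn _ _) (xn _ _)).
have [s xs] : exists s, adj T0 x (bnd i s).
  case/and5P: path xpq => _ _ up _ qv [] E; subst.
    by exists true; move: up; rewrite /eq_or_adj eq_sym (negPf (xn _ _)) adj_sym.
  by exists false; move: qv; rewrite /eq_or_adj (negPf (xn _ _)).
have [p1 [_ [_ xsp _]]] := near_edge pre_irreducible_near xs xF.
have [_ xp sp] := face_adj T0_pure xsp.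
have [j [p' [q' [path' on']]]] := pre_irreducible_edges (fx p1 xp) (xE p1).
have xpq' : x = p' \/ x = q' by exact: (on_lazy_path_inner on' (xn _ _) (xn _ _)).
case: (eqVneq i j) => [ij|ij]; last first.
  by exists i, j; split=> //; [exists p, q|exists p', q'].
subst j; exfalso.
have nt x' p2 : x' \notin Fr -> adj T0 x' p2 -> p2 != t' V.
  move=> x'F /adj_face[_ [F [FT x'in pin]]].
  have [f [X [fT FE _ _ _]]] := interior_face FT x'in x'F.
  rewrite FE in pin; have [_ <-] := corner_proj pin.
  by rewrite /cut_corner; case: pickP.
have ptn := nt x p1 xF xp.
have xtn : x != t' V.
  have [|f [X [_ _ _ _ ->]]] := interior_face xyz _ xF; last by [].
  by rewrite !inE eqxx.
have pn r : p1 != bnd i r.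
  apply/eqP=> pE; case: (s =P r) => [sr|/eqP sr].
    by have := adj_neq sp; rewrite pE sr eqxx.
  have {sr} rs : r = ~~ s by case: s r sr {xs xsp sp pE} => -[].
  rewrite pE rs in xp.
  by case: s xs xp {xsp sp pE rs} => H1 H2; apply: (adj_one_side xtn (i := i)).
have up r : p1 = bnd i r -> False by move=> E; move: (pn r); rewrite E eqxx.
have ux r : x = bnd i r -> False by move=> E; move: (xn i r); rewrite E eqxx.
have clash : adj T0 x (u i) && adj T0 p1 (v i) || adj T0 p1 (u i) && adj T0 x (v i).
  case/and5P: path' => _ _ up' _ qv'.
  have adjE r t : eq_or_adj T0 (bnd i r) t -> t = x \/ t = p1 -> adj T0 t (bnd i r).
    rewrite /eq_or_adj eq_sym adj_sym => /orP[/eqP tE|//].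
    by case=> E; [case: (ux r)|case: (up r)]; rewrite -E.
  rewrite eq_or_adj_sym in qv'.
  case/or3P: on' => /orP[]/andP[/eqP E1 /eqP E2];
    try (by case: (ux _ E1)); try (by case: (up _ E2)); subst p' q'.
    by rewrite (adjE true _ up') ?(adjE false _ qv'); auto.
  by rewrite (adjE true _ up') ?(adjE false _ qv') ?orbT; auto.
have spr r : s = r -> adj T0 x (bnd i r) /\ adj T0 p1 (bnd i r).
  by move=> <-; split=> //; rewrite adj_sym.
case: s spr {xs xsp sp} => spr; have [] := spr _ erefl => x1 p1'.
  case/orP: clash => /andP[]; last by move=> _ /(adj_one_side xtn x1).
  by move=> _ /(adj_one_side ptn p1').
case/orP: clash => /andP[]; first by move=> H _; apply: (adj_one_side xtn H x1).
by move=> H _; apply: (adj_one_side ptn H p1').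
Qed.

End PreIrreducible.

Lemma card_set_sum (V : finType) (P : pred V) :
  #|[set y | P y]| = \sum_y (P y : nat).
Proof. by rewrite -sum1dep_card big_mkcond; apply: eq_bigr => y _; case: (P y). Qed.

Lemma sum_out_in (V : finType) (r : rel V) :
  \sum_x #|[set y | r x y]| = \sum_x #|[set y | r y x]|.
Proof.
under eq_bigr do rewrite card_set_sum; rewrite exchange_big.
by apply: eq_bigr => x _; rewrite card_set_sum.
Qed.

Lemma sum_sym_even (V : finType) (r : rel V) : symmetric r -> irreflexive r ->
  ~~ odd (\sum_x #|[set y | r x y]|).
Proof.
move=> rC rI; pose lt x y := r x y && (enum_rank x < enum_rank y).
have -> : \sum_x #|[set y | r x y]| =
    \sum_x #|[set y | lt x y]| + \sum_x #|[set y | lt y x]|.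
  rewrite -big_split; apply: eq_bigr => x _ /=; rewrite !card_set_sum -big_split.
  apply: eq_bigr => y _; rewrite /lt (rC y); case rxy: (r x y) => //=.
  case: ltngtP => // E; have xy : x = y by apply: enum_rank_inj; apply: val_inj.
  by rewrite xy rI in rxy.
by rewrite (sum_out_in lt) addnn odd_double.
Qed.

Lemma card_edges (V : finType) (T : {set {set V}}) : triangulation T ->
  2 * #|edges T| = 3 * #|T|.
Proof.
move=> TT; have pT := tri_face TT.
have -> : 2 * #|edges T| = \sum_(e in edges T) \sum_(f in T) (e \subset f : nat).
  rewrite mulnC -sum_nat_const; apply: eq_bigr => e eT.
  rewrite -(tri_edge TT eT) card_set_sum [RHS]big_mkcond /=.
  by apply: eq_bigr => f _; case: (f \in T).
rewrite exchange_big mulnC -sum_nat_const /=; apply: eq_bigr => f fT.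
transitivity #|[set e : {set V} | e \subset f & #|e| == 2]|.
  rewrite card_set_sum [LHS]big_mkcond /=; apply: eq_bigr => e _.
  case: (boolP (e \subset f)) => ef; rewrite ?if_same // inE.
  by case: (#|e| == 2) => //=; case: exists_inP => // -[]; exists f.
by rewrite cards_draws pT.
Qed.

Section OrientationRules.
Variables (V : finType) (T : {set {set V}}) (o : V -> V -> V -> bool).
Hypothesis oT : orientation T o.

Lemma orient_rot x y z : [set x; y; z] \in T -> o y z x = o x y z.
Proof. by case/oT. Qed.

Lemma orient_swap x y z : [set x; y; z] \in T -> o x z y = ~~ o x y z.
Proof. by case/oT. Qed.

Lemma orient_edge x y z t : [set x; y; z] \in T -> t != z -> [set x; y; t] \in T ->
  o x y t = ~~ o x y z.
Proof. by case/oT=> _ _; apply. Qed.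

Lemma orient_swap12 x y z : [set x; y; z] \in T -> o y x z = ~~ o x y z.
Proof. by move=> xyz; rewrite -(orient_swap xyz) (orient_rot (x := y)) // set3C. Qed.

End OrientationRules.

Section FlatContraction.
Variables (V : finType) (T : {set {set V}}) (a c : V).
Hypotheses (TT : triangulation T) (fac : flat T a c).
Hypothesis no_tetra : forall x y, [set a; x; y] \in T -> [set c; x; y] \notin T.
Implicit Types (x y z t h k p q : V) (f g : {set V}).
Local Notation m := (Defs.merge a c).
Local Notation T2 := (contract T a c).

Let pT : pure T := tri_face TT.
Let ac := flat_adj fac.
Let nac := adj_neq ac.
Let nca : c != a. Proof. by rewrite eq_sym nac. Qed.
Let pT2 := contract_pure pT nac.
Let nT := near_tri set0 TT.
Let a0 : a \notin set0. Proof. by rewrite inE. Qed.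
Let c0 : c \notin set0. Proof. by rewrite inE. Qed.

Lemma face_merge x y z : [set x; y; z] \in T ->
  m x != m y -> m x != m z -> m y != m z -> [set m x; m y; m z] \in T2.
Proof.
move=> xyz xy xz yz; apply/contractP; exists [set x; y; z]; rewrite merge_set3.
split=> //; apply/negP=> /andP[ain cin].
have eqm s t : a = s -> c = t -> m s = m t.
  by move=> <- <-; rewrite (merge_l nac) merge_r.
move: ain cin; rewrite !inE -!orbA => /or3P[]/eqP E1 /or3P[]/eqP E2.
- by case/eqP: nac; rewrite E1 E2.
- by rewrite (eqm _ _ E1 E2) eqxx in xy.
- by rewrite (eqm _ _ E1 E2) eqxx in xz.
- by rewrite (eqm _ _ E1 E2) eqxx in xy.
- by case/eqP: nac; rewrite E1 E2.
- by rewrite (eqm _ _ E1 E2) eqxx in yz.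
- by rewrite (eqm _ _ E1 E2) eqxx in xz.
- by rewrite (eqm _ _ E1 E2) eqxx in yz.
- by case/eqP: nac; rewrite E1 E2.
Qed.

Lemma other_face x y z : [set x; y; z] \in T -> exists p,
  [/\ p != z, [set x; y; p] \in T & forall r, [set x; y; r] \in T -> r = z \/ r = p].
Proof.
move=> xyz; have [xy _ _] := face_adj pT xyz.
have [p [q [pq xp xq all]]] := tri_two_faces TT xy.
case: (all _ xyz) => ->; last by exists p; split=> // r /all[]; auto.
by exists q; rewrite eq_sym; split.
Qed.

Lemma contract_two_faces x y : adj T2 x y -> two_faces T2 x y.
Proof.
have off x' y' : x' != a -> y' != a -> adj T2 x' y' -> two_faces T2 x' y'.
  move=> xa ya xy2; have [xc yc] := adj_contract_neq nac xy2.
  have xy := adj_contract_off pT nac xa ya xy2.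
  have [p [q [pq xp xq all]]] := tri_two_faces TT xy.
  have face r : [set x'; y'; r] \in T -> [set x'; y'; m r] \in T2.
    move=> xyr; have [nxy xr yr] := face_neq pT xyr.
    have neq s t : s != a -> s != c -> s != t -> m s != m t.
      move=> sa sc st; rewrite (merge_neq _ sc); apply: contraNneq st => E.
      by rewrite (merge_eq sa (esym E)).
    have := face_merge xyr (neq _ _ xa xc nxy) (neq _ _ xa xc xr) (neq _ _ ya yc yr).
    by rewrite (merge_neq a xc) (merge_neq a yc).
  exists (m p), (m q); split; rewrite ?face //.
    apply/eqP=> /(merge_inj nac)[E|[pE qE]|[pE qE]]; first by rewrite E eqxx in pq.
      by rewrite pE -set3_rot in xp; rewrite qE -set3_rot in xq;
         have := no_tetra xp; rewrite xq.
    by rewrite qE -set3_rot in xq; rewrite pE -set3_rot in xp;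
       have := no_tetra xq; rewrite xp.
  move=> r; case: (eqVneq r a) => [->|ra] xyr; last first.
    have rc : r != c by apply: (contract_neq nac xyr); rewrite !inE eqxx orbT.
    by rewrite -(merge_neq a rc); case: (all _ (contract3_off pT nac xyr xa ya ra)) => ->; auto.
  rewrite -set3_rot in xyr; have [h [hac]] := contract3_at pT nac xyr.
  rewrite set3_rot => /all[] <-; [left|right]; case: hac => ->; by rewrite ?(merge_l nac) ?merge_r.
have at_a y' : adj T2 a y' -> two_faces T2 a y'.
  move=> ay2; have ya : y' != a by rewrite eq_sym (adj_neq ay2).
  have [_ yc] := adj_contract_neq nac ay2.
  have [h [hac hy]] := adj_contract_at pT nac ya ay2.
  have [k hk] := ends_of hac.
  have r_off r : [set a; y'; r] \in T2 -> r != a /\ r != c.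
    move=> ayr; split; first by case: (face_neq pT2 ayr) => _; rewrite eq_sym.
    by apply: (contract_neq nac ayr); rewrite !inE eqxx orbT.
  case: (boolP (adj T k y')) => ky.
    have [aY cY] : adj T a y' /\ adj T c y' by case: hk hy ky => -[-> ->].
    have acy := flat_face fac aY cY.
    have ayc : [set a; y'; c] \in T by rewrite set3AC.
    have cya : [set c; y'; a] \in T by rewrite -set3_rot.
    have [p [pc ayp allp]] := other_face ayc.
    have [q [qa cyq allq]] := other_face cya.
    have [_ pa _] := face_neq pT ayp; have [_ qc _] := face_neq pT cyq.
    rewrite eq_sym in pa; rewrite eq_sym in qc.
    exists p, q; split.
    - by apply: contraTneq ayp => ->; apply: contraL cyq; apply: no_tetra.
    - by apply: (face_contract_at nac (or_introl erefl)).
    - by apply: (face_contract_at nac (or_intror erefl)).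
    - move=> r ayr; have [ra rc] := r_off r ayr.
      have [h' [[] -> ]] := contract3_at pT nac ayr.
        by case/allp=> E; [rewrite E eqxx in rc|left].
      by case/allq=> E; [rewrite E eqxx in ra|right].
  have [p [q [pq hp hq all]]] := tri_two_faces TT hy.
  have not_k r : [set h; y'; r] \in T -> r != a /\ r != c.
    move=> hyr; have rk : r != k.
      apply: contraNneq ky => <-; rewrite adj_sym.
      by case: (face_adj pT hyr).
    have [_ rh _] := face_neq pT hyr; rewrite eq_sym in rh.
    by case: hk rk rh => -[-> ->].
  have [pa pc] := not_k p hp; have [qa qc] := not_k q hq.
  exists p, q; split=> //; try by apply: (face_contract_at nac hac).
  move=> r ayr; have [h' [hac' h'yr]] := contract3_at pT nac ayr.
  have [E|E] : h' = h \/ h' = k by case: hk hac' => -[-> ->] []; auto.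
    by apply: all; rewrite -E.
  by subst h'; case/negP: ky; case: (face_adj pT h'yr).
case: (eqVneq x a) => [->|xa]; first exact: at_a.
case: (eqVneq y a) => [->|ya]; last exact: off.
by rewrite adj_sym => /at_a/two_facesC.
Qed.

(* The link of a without c is a path joining the apexes b, d of the two faces
   at ac: otherwise the component of b in it would have a single vertex of odd
   degree. *)
Definition link_off y z : bool := [&& [set a; y; z] \in T, y != c & z != c].

Lemma link_offC : symmetric link_off.
Proof. by move=> y z; rewrite /link_off set3AC; congr (_ && _); rewrite andbC. Qed.

Lemma link_off_sub y z : link_off y z -> [set a; y; z] \in T2.
Proof. by case/and3P=> ayz yc zc; apply: face_contract. Qed.

Lemma link_off_apex b : [set a; c; b] \in T -> exists2 p,
  [set y | link_off b y] = [set p] & [set a; b; p] \in T.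
Proof.
move=> acb; have abc : [set a; b; c] \in T by rewrite set3AC.
have [_ _ bc] := face_neq pT abc.
have [p [pc abp all]] := other_face abc; exists p => //.
apply/setP=> y; rewrite !inE /link_off bc /=; apply/andP/eqP => [[]|-> //].
by case/all=> [->|//]; rewrite eqxx.
Qed.

Lemma link_off_inner x : adj T a x -> x != c -> [set a; c; x] \notin T ->
  exists p q, [/\ p != q, [set y | link_off x y] = [set p; q],
    [set a; x; p] \in T & [set a; x; q] \in T].
Proof.
move=> ax xc acx; have [p [q [pq axp axq all]]] := tri_two_faces TT ax.
exists p, q; split=> //; apply/setP=> y; rewrite !inE /link_off xc /=.
have not_c r : [set a; x; r] \in T -> r != c.
  by move=> axr; apply: contraNneq acx => <-; rewrite set3AC.
apply/andP/orP => [[/all[]->]|]; rewrite ?eqxx; auto.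
by case=> /eqP->; rewrite not_c.
Qed.

Lemma link_off_connect b d : [set a; c; b] \in T -> [set a; c; d] \in T -> b != d ->
  connect link_off b d.
Proof.
move=> acb acd bd; apply: contraT => ncd.
have [_ ab cb] := face_neq pT acb.
have [p [pb acp allc]] := other_face acb.
have only x : [set a; c; x] \in T -> x = b \/ x = d.
  move: bd; case: (allc _ acd) => ->; first by rewrite eqxx.
  by move=> _ /allc.
pose r x y := connect link_off b x && link_off x y.
have /negP[] : ~~ odd (\sum_x #|[set y | r x y]|).
  apply: sum_sym_even => x => [y|]; last first.
    by rewrite /r /link_off; apply/negP=> /and3P[_ /(face_neq pT)[_ _]]; rewrite eqxx.
  rewrite /r (link_offC y); case xy: (link_off x y); rewrite ?andbF // !andbT.
  apply/idP/idP => bx; apply: connect_trans bx _; apply: connect1 => //.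
  by rewrite link_offC.
have K x : connect link_off b x -> x != b -> #|[set y | r x y]| = 2.
  move=> bx xb; rewrite /r bx.
  have [ax xc] : adj T a x /\ x != c.
    have step y z : adj T a y /\ y != c -> link_off y z -> adj T a z /\ z != c.
      by move=> _ /and3P[/(face_adj pT)[]].
    apply: (connect_ind_pred step _ bx).
    by split; [case: (face_adj pT acb)|rewrite eq_sym].
  have acx : [set a; c; x] \notin T.
    apply/negP=> /only[] E; first by rewrite E eqxx in xb.
    by rewrite -E bx in ncd.
  have [s [t [st -> _ _]]] := link_off_inner ax xc acx.
  by rewrite cards2 st.
rewrite (bigD1 b) //= oddD {1}/r connect0.
have [s -> _] := link_off_apex acb; rewrite cards1.
rewrite (eq_bigr (fun x => 2 * connect link_off b x)); last first.
  move=> x xb; case bx: (connect link_off b x); first exact: K.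
  by apply/eqP; rewrite /r bx cards_eq0; apply/eqP/setP=> y; rewrite !inE.
by rewrite -big_distrr /= oddM.
Qed.

Lemma contract_link x y z : adj T2 x y -> adj T2 x z ->
  connect (fun y' z' => [set x; y'; z'] \in T2) y z.
Proof.
move=> xy2 xz2; set L := (fun y' z' => _).
have LC : symmetric L by move=> s t; rewrite /L set3AC.
case: (eqVneq x a) => [xa|xa]; last first.
  have [xc _] := adj_contract_neq nac xy2.
  have lift t : adj T2 x t -> exists2 t', m t' = t & adj T x t'.
    by case/(adj_contract_inv pT nac) => x' [t' [/(merge_eq xa)-> <-]]; exists t'.
  have [y' <- xy] := lift y xy2; have [z' <- xz] := lift z xz2.
  have step s t : connect L (m y') (m s) -> [set x; s; t] \in T -> connect L (m y') (m t).
    move=> ys xst; apply: connect_trans ys _.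
    case: (eqVneq (m s) (m t)) => [->|mst]; first exact: connect0.
    have neq r : x != r -> m x != m r.
      move=> xr; rewrite (merge_neq _ xc); apply: contraNneq xr => E.
      by rewrite (merge_eq xa (esym E)).
    have [xs xt _] := face_neq pT xst.
    apply: connect1; rewrite /L -{1}(merge_neq a xc); apply: face_merge => //; exact: neq.
  exact: (connect_ind_pred step (connect0 _ _) (tri_link TT xy xz)).
subst x.
have [b [d [bd acb acd all]]] := tri_two_faces TT ac.
have bdL : connect L b d.
  have := link_off_connect acb acd bd; apply: connect_sub => s t st.
  by apply: connect1; apply: link_off_sub.
have to_b t : adj T2 a t -> connect L t b.
  move=> at2; have ta : t != a by rewrite eq_sym (adj_neq at2).
  have [_ tc] := adj_contract_neq nac at2.
  have [h [hac ht]] := adj_contract_at pT nac ta at2; have [k hk] := ends_of hac.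
  have neq s : s != h -> s != k -> s != a /\ s != c by case: hk => -[-> ->].
  have step s r : s = k \/ connect L s b -> [set h; s; r] \in T -> r = k \/ connect L r b.
    move=> Ps hsr; case: (eqVneq r k) => [|rk]; [by left|right].
    have [hs hr _] := face_neq pT hsr; rewrite eq_sym in hs; rewrite eq_sym in hr.
    case: (eqVneq s k) Ps => [sk _|sk [/eqP|sb]]; last 2 first.
    - by rewrite (negPf sk).
    - have [[sa sc] [ra rc]] := (neq s hs sk, neq r hr rk).
      apply: connect_trans sb; apply: connect1; rewrite LC.
      exact: (face_contract_at nac (ends_fst hk) hsr).
    have acr : [set a; c; r] \in T.
      by rewrite sk in hsr; case: hk hsr => -[-> ->] //; rewrite set3C.
    by case: (all _ acr) => ->; rewrite ?connect0 // (sym_connect_sym LC).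
  have tk : t = k \/ connect L t b.
    apply: (connect_ind_pred step _ (tri_link TT (flat_adj (ends_flat fac hk)) ht)).
    by left.
  case: tk => // tk; case: hk => -[_ kE]; first by rewrite tk kE eqxx in tc.
  by rewrite tk kE eqxx in ta.
have sym : connect_sym L := sym_connect_sym LC.
by apply: connect_trans (to_b y xy2) _; rewrite sym; apply: to_b.
Qed.

Lemma contract_vertices : vertices T2 = vertices T :\ c.
Proof.
apply/setP=> x; rewrite in_setD1; apply/idP/andP=> [/(vertexP pT2)[y [z xyz]]|[xc]].
  split; first by apply: (contract_neq nac xyz); rewrite !inE eqxx.
  case: (eqVneq x a) => [->|xa]; first exact: adj_vertex ac.
  have [x' [y' [z' [x'E _ _ xyz']]]] := contract3 pT nac xyz.
  by rewrite -(merge_eq xa x'E) (face_vertex xyz') // !inE eqxx.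
move=> /(vertexP pT)[y [z xyz]]; have [xy xz yz] := face_adj pT xyz.
have [t xt mt] : exists2 t, adj T x t & m x != m t.
  have eq_c t : adj T x t -> m x = m t -> t = c.
    move=> /adj_neq xt /(merge_inj nac)[E|[_ ->] //|[E _]].
      by rewrite E eqxx in xt.
    by rewrite E eqxx in xc.
  case: (eqVneq (m x) (m y)) => [/(eq_c y xy) yE|]; last by exists y.
  case: (eqVneq (m x) (m z)) => [/(eq_c z xz) zE|]; last by exists z.
  by have := adj_neq yz; rewrite yE zE eqxx.
have := adj_contract nT a0 c0 fac xt mt; rewrite (merge_neq _ xc).
exact: adj_vertex.
Qed.

Lemma contract_tri : triangulation T2.
Proof.
split.
- have aT2 : a \in vertices T2 by rewrite contract_vertices in_setD1 nac (adj_vertex ac).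
  by case/(vertexP pT2): aT2 => y [z ayz]; apply/set0Pn; exists [set a; y; z].
- exact: pT2.
- by move=> e; apply: two_faces_edge pT2 (contract_two_faces).
- by move=> x y z; apply: contract_link.
move=> x y; rewrite contract_vertices !in_setD1 => /andP[xc xT] /andP[yc yT].
have step s t : connect (adj T2) x (m s) -> adj T s t -> connect (adj T2) x (m t).
  move=> xs st; case: (eqVneq (m s) (m t)) => [<- //|mst].
  by apply: connect_trans xs _; apply: connect1; apply: (adj_contract nT a0 c0 fac).
rewrite -(merge_neq a yc); apply: (connect_ind_pred step _ (tri_connected TT xT yT)).
by rewrite (merge_neq a xc).
Qed.

Lemma merge_face_inj f g : f \in T -> g \in T ->
  ~~ ((a \in f) && (c \in f)) -> ~~ ((a \in g) && (c \in g)) ->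
  m @: f = m @: g -> f = g.
Proof.
move=> fT gT acf acg E; apply/eqP; rewrite eqEcard !pT // leqnn andbT.
apply/subsetP=> x xf; apply: contraT => xg.
have : m x \in m @: g by rewrite -E imset_f.
case/imsetP=> y yg mxy.
(* Otherwise f = h s t and g = k s t with {h, k} = {a, c}, against no_tetra. *)
have apexes h k f' g' : f' \in T -> g' \in T -> m @: f' = m @: g' ->
    ~~ (k \in f') -> ~~ (h \in g') -> ends a c h k ->
    h \in f' -> k \in g' -> exists s t, [set h; s; t] \in T /\ [set k; s; t] \in T.
  move=> f'T g'T E' kf hg hk hf kg.
  have [s sf hs] : exists2 s, s \in f' & h != s.
    have /card_gt0P[s] : 0 < #|f' :\ h|.
      by have := pT f'T; rewrite (cardsD1 h) hf add1n => -[->].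
    by rewrite !inE eq_sym => /andP[hs sf]; exists s.
  have [t fE] := card3_third (pT f'T) hf sf hs.
  exists s, t; split; first by rewrite -fE.
  have tr r : r \in f' -> r != h -> r \in g'.
    move=> rf rh; have rk : r != k by apply: contraNneq kf => <-.
    have [ra rc] : r != a /\ r != c by case: hk rh rk => -[-> ->].
    have : m r \in m @: g' by rewrite -E' imset_f.
    by rewrite (merge_neq a rc) => /imsetP[r' r'g /esym/(merge_eq ra) <-].
  have [_ ht st] : [/\ h != s, h != t & s != t] by apply: (face_neq pT); rewrite -fE.
  have tf : t \in f' by rewrite fE !inE eqxx orbT.
  have sg : s \in g' by apply: tr; rewrite // eq_sym.
  have tg : t \in g' by apply: tr; rewrite // eq_sym.
  rewrite -(eq_set3 (pT g'T) kg sg tg) //.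
    by apply: contraNneq kf => ->.
  by apply: contraNneq kf => ->.
case: (merge_inj nac mxy) => [xy|[xa yc]|[xc ya]]; first by rewrite xy yg in xg.
  subst x y; have cf : c \notin f by move: acf; rewrite xf.
  have [s [t [ast cst]]] :=
    apexes a c f g fT gT E cf xg (or_introl (conj erefl erefl)) xf yg.
  by have := no_tetra ast; rewrite cst.
subst x y; have af : a \notin f by move: acf; rewrite xf andbT.
have [s [t [ct at_]]] :=
  apexes c a f g fT gT E af xg (or_intror (conj erefl erefl)) xf yg.
by have := no_tetra at_; rewrite ct.
Qed.

Lemma card_contract : #|T| = #|T2| + 2.
Proof.
have cE : #|[set f in T | [set a; c] \subset f]| = 2 by apply: tri_edge TT _ ac.
have -> : #|T2| = #|[set f in T | ~~ ([set a; c] \subset f)]|.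
  apply: card_in_imset => f g; rewrite !inE !subUset !sub1set => /andP[fT acf] /andP[gT acg].
  exact: merge_face_inj.
rewrite -cE addnC -(cardsID [set f : {set V} | [set a; c] \subset f] T).
by congr (_ + _); apply: eq_card => f; rewrite !inE // andbC.
Qed.

Lemma contract_euler : euler_char T = euler_char T2.
Proof.
have := card_edges TT; have := card_edges contract_tri; have := card_contract.
have := cardsD1 c (vertices T); rewrite -contract_vertices.
have -> : c \in vertices T by rewrite (adj_vertex (y := a)) // adj_sym.
rewrite /euler_char; lia.
Qed.

Definition unmerge x := if x == a then c else x.

Lemma unmerge_neq x : x != a -> unmerge x = x.
Proof. by rewrite /unmerge => /negPf->. Qed.

Lemma unmerge_l : unmerge a = c.
Proof. by rewrite /unmerge eqxx. Qed.

Lemma unmerge_face x y z : [set x; y; z] \in T2 ->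
  [set x; y; z] \in T \/ [set unmerge x; unmerge y; unmerge z] \in T.
Proof.
have at_a y' z' : [set a; y'; z'] \in T2 ->
    [set a; y'; z'] \in T \/ [set unmerge a; unmerge y'; unmerge z'] \in T.
  move=> ayz; have [ay az _] := face_neq pT2 ayz.
  have [h [[] -> hyz]] := contract3_at pT nac ayz; first by left.
  by right; rewrite unmerge_l !unmerge_neq // eq_sym.
move=> xyz; case: (eqVneq x a) xyz => [->|xa] xyz; first exact: at_a.
case: (eqVneq y a) xyz => [->|ya] xyz.
  by move: xyz; rewrite set3C => /at_a; rewrite set3C (set3C (unmerge a)).
case: (eqVneq z a) xyz => [->|za] xyz.
  by move: xyz; rewrite -set3_rot => /at_a; rewrite set3_rot (set3_rot (unmerge a)).
by left; apply: (contract3_off pT nac xyz).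
Qed.

Lemma contract_orientable : orientable T -> orientable T2.
Proof.
case=> o oT.
pose o2 x y z := if [set x; y; z] \in T then o x y z
  else o (unmerge x) (unmerge y) (unmerge z).
have mixed_a y z t : [set a; y; z] \in T -> [set c; y; t] \in T -> z != c -> t != a ->
    o c y t = ~~ o a y z.
  move=> ayz cyt zc ta; have [ay _ _] := face_adj pT ayz; have [cy _ _] := face_adj pT cyt.
  have acy := flat_face fac ay cy.
  have ayc : [set a; y; c] \in T by rewrite set3AC.
  have cya : [set c; y; a] \in T by rewrite -set3_rot.
  rewrite (orient_edge oT cya ta cyt) (orient_edge oT ayc zc ayz).
  by rewrite (orient_swap oT acy) (orient_rot oT acy) negbK.
have off x y z : [set x; y; z] \in T2 -> [/\ x != c, y != c & z != c].
  by move=> xyz; split; apply: (contract_neq nac xyz); rewrite !inE eqxx ?orbT.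
have mixed x y z t : [set x; y; z] \in T2 -> [set x; y; t] \in T2 -> t != z ->
    [set x; y; z] \in T -> [set unmerge x; unmerge y; unmerge t] \in T ->
    [set x; y; t] \notin T ->
    o (unmerge x) (unmerge y) (unmerge t) = ~~ o x y z.
  move=> xyz2 xyt2 tz xyz; have [xc yc zc] := off _ _ _ xyz2.
  have [_ _ tc] := off _ _ _ xyt2.
  have [xy xt yt] := face_neq pT2 xyt2.
  case: (eqVneq x a) => [xa|xa].
    rewrite xa in xyz xy xt *; rewrite eq_sym in xy; rewrite eq_sym in xt.
    by rewrite unmerge_l !unmerge_neq // => cyt _; apply: mixed_a.
  case: (eqVneq y a) => [ya|ya].
    rewrite ya in xyz xy yt *; rewrite eq_sym in yt.
    rewrite unmerge_l !unmerge_neq // => xct _.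
    rewrite set3C in xyz; rewrite set3C in xct.
    rewrite (orient_swap12 oT xct) (orient_swap12 oT xyz); congr (~~ _).
    exact: mixed_a.
  rewrite (unmerge_neq xa) (unmerge_neq ya).
  case: (eqVneq t a) => [ta|ta].
    by rewrite ta unmerge_l => xyc _; apply: (orient_edge oT xyz _ xyc); rewrite eq_sym.
  by rewrite unmerge_neq // => ->.
exists o2 => x y z xyz2; rewrite /o2; split.
- rewrite -set3_rot; case: ifP => [/(orient_rot oT)//|xyz].
  case: (unmerge_face xyz2) => [|H]; first by rewrite xyz.
  exact: (orient_rot oT H).
- rewrite set3AC; case: ifP => [/(orient_swap oT)//|xyz].
  case: (unmerge_face xyz2) => [|H]; first by rewrite xyz.
  exact: (orient_swap oT H).
move=> t tz xyt2.
case: ifP => [xyt|/negbT xyt]; case: ifP => [xyz|/negbT xyz].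
- exact: (orient_edge oT xyz tz xyt).
- case: (unmerge_face xyz2) => [|H]; first by rewrite (negPf xyz).
  by rewrite (mixed x y t z) 1?eq_sym // negbK.
- case: (unmerge_face xyt2) => [|H]; first by rewrite (negPf xyt).
  exact: mixed.
case: (unmerge_face xyz2) => [|H]; first by rewrite (negPf xyz).
case: (unmerge_face xyt2) => [|H']; first by rewrite (negPf xyt).
apply: (orient_edge oT H _ H'); apply: contraNneq tz.
have [_ _ zc] := off _ _ _ xyz2; have [_ _ tc] := off _ _ _ xyt2.
rewrite /unmerge; case: (eqVneq t a) => [tE|_]; case: (eqVneq z a) => [zE|_] E.
- by rewrite tE zE.
- by rewrite -E eqxx in zc.
- by rewrite E eqxx in tc.
- by rewrite E.
Qed.

Section Lift.
Variable o2 : V -> V -> V -> bool.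
Hypothesis oT2 : orientation T2 o2.

(* The orientation that the face a c t inherits from its neighbour across a t. *)
Definition side_orient t := [exists p, link_off t p && o2 a t p].

Lemma side_orientE t p : [set a; c; t] \in T -> [set a; t; p] \in T -> p != c ->
  side_orient t = o2 a t p.
Proof.
move=> act atp pc; have [q E _] := link_off_apex act.
have [_ _ ct] := face_neq pT act; rewrite eq_sym in ct.
have tp : link_off t p by rewrite /link_off atp ct pc.
have inq s : link_off t s = (s == q) by rewrite -in_set1 -E inE.
apply/existsP/idP => [[s /andP[]]|op]; last by exists p; rewrite tp.
by move: tp; rewrite !inq => /eqP-> /eqP->.
Qed.

(* In the path of link vertices of a from b to d, each edge has one tail and one
   head, each inner vertex is once a tail and once a head. *)
Lemma side_orient_opp b d : [set a; c; b] \in T -> [set a; c; d] \in T -> d != b ->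
  side_orient d = ~~ side_orient b.
Proof.
move=> acb acd db.
have := sum_out_in (fun x y => link_off x y && o2 a x y).
rewrite (bigD1 b) //= (bigD1 d) //= [RHS](bigD1 b) //= [in RHS](bigD1 d) //=.
have apex t : [set a; c; t] \in T ->
    #|[set y | link_off t y && o2 a t y]| = side_orient t /\
    #|[set y | link_off y t && o2 a y t]| = ~~ side_orient t.
  move=> act; have [p E atp] := link_off_apex act.
  have inp y : link_off t y = (y == p) by rewrite -in_set1 -E inE.
  have tp : link_off t p by rewrite inp.
  have pc : p != c by case/and3P: tp.
  have atp2 := link_off_sub tp; rewrite (side_orientE act atp pc).
  have card1 (P : pred V) : #|[set y | (y == p) && P y]| = P p.
    case Pp: (P p).
      rewrite (_ : [set y | _] = [set p]) ?cards1 //; apply/setP=> y; rewrite !inE.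
      by case: eqP => // ->.
    apply/eqP; rewrite cards_eq0; apply/eqP/setP=> y; rewrite !inE.
    by case: eqP => // ->.
  split; first by rewrite -card1; apply: eq_card => y; rewrite !inE inp.
  rewrite -(orient_swap oT2 atp2) -(card1 (fun y => o2 a y t)).
  by apply: eq_card => y; rewrite !inE link_offC inp.
rewrite !(proj1 (apex _ _)) // !(proj2 (apex _ _)) //.
rewrite (eq_bigr (fun x => #|[set y | link_off y x && o2 a y x]|)).
  rewrite !addnA => /addIn; by case: (side_orient b); case: (side_orient d).
move=> x /andP[xb xd].
case: (boolP (adj T a x && (x != c))) => [/andP[ax xc]|nx]; last first.
  have no y : link_off x y = false.
    apply/negP=> /and3P[axy xc _]; case/negP: nx; rewrite xc andbT.
    by case: (face_adj pT axy).
  by apply: eq_card => y; rewrite !inE (link_offC y x) no.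
have acx : [set a; c; x] \notin T.
  apply/negP=> acx; have [p [q [_ _ _ all]]] := tri_two_faces TT ac.
  by move: xb xd db; case: (all _ acb) => ->; case: (all _ acd) => ->;
     case: (all _ acx) => ->; rewrite eqxx.
have [p [q [pq E axp axq]]] := link_off_inner ax xc acx.
have inpq y : link_off x y = (y == p) || (y == q) by rewrite -in_set2 -E inE.
have axp2 : [set a; x; p] \in T2 by apply: (link_off_sub (y := x)); rewrite inpq eqxx.
have axq2 : [set a; x; q] \in T2 by apply: (link_off_sub (y := x)); rewrite inpq eqxx orbT.
have opq : o2 a x q = ~~ o2 a x p by apply: (orient_edge oT2 axp2); rewrite // eq_sym.
have card1 (P : pred V) : P q = ~~ P p -> #|[set y | ((y == p) || (y == q)) && P y]| = 1.
  move=> Pq; apply/eqP/cards1P; exists (if P p then p else q); apply/setP=> y; rewrite !inE.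
  case: (eqVneq y p) => [->|yp] /=.
    by case: (P p); rewrite ?eqxx ?(negPf pq).
  by case: (eqVneq y q) => [->|yq]; rewrite ?Pq /=; case: (P p);
     rewrite ?eqxx // ?(negPf yp) ?(negPf yq) // eq_sym (negPf pq).
transitivity 1.
  by rewrite -(card1 (o2 a x)) //; apply: eq_card => y; rewrite !inE inpq.
rewrite -(card1 (fun y => o2 a y x)).
  by apply: eq_card => y; rewrite !inE link_offC inpq.
by rewrite (orient_swap oT2 axp2) (orient_swap oT2 axq2) opq.
Qed.

Lemma edge_orient_l s t : [set a; c; s] \in T -> [set a; s; t] \in T -> t != c ->
  o2 a s t = side_orient s.
Proof. by move=> acs ast tc; rewrite (side_orientE acs ast tc). Qed.

Lemma edge_orient_r s t : [set a; c; s] \in T -> [set c; s; t] \in T -> t != a ->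
  o2 a s t = ~~ side_orient s.
Proof.
move=> acs cst ta; have [p E asp] := link_off_apex acs.
have sp : link_off s p by rewrite -[_ s p]inE -/(p \in [set y | link_off s y]) E set11.
have [_ sc pc] := and3P sp; rewrite (side_orientE acs asp pc).
have [_ as_ _] := face_neq pT acs; rewrite eq_sym in as_.
have [_ ct _] := face_neq pT cst; rewrite eq_sym in ct.
apply: (orient_edge oT2 (link_off_sub sp)).
  by apply: contraTneq cst => ->; apply: no_tetra.
exact: (face_contract_at nac (or_intror erefl)).
Qed.

Definition lift_orient x y z :=
  if (x == a) && (y == c) then side_orient z
  else if (y == a) && (z == c) then side_orient x
  else if (z == a) && (x == c) then side_orient y
  else if (x == c) && (y == a) then ~~ side_orient z
  else if (y == c) && (z == a) then ~~ side_orient x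
  else if (z == c) && (x == a) then ~~ side_orient y
  else o2 (m x) (m y) (m z).

Lemma lift_orientE t : t != a -> t != c ->
  ((lift_orient a c t = side_orient t) * (lift_orient c t a = side_orient t) *
   (lift_orient t a c = side_orient t)) *
  ((lift_orient c a t = ~~ side_orient t) * (lift_orient a t c = ~~ side_orient t) *
   (lift_orient t c a = ~~ side_orient t)).
Proof.
move=> /negPf ta /negPf tc.
by rewrite /lift_orient !eqxx ta tc (negPf nac) (eq_sym c) (negPf nac).
Qed.

Lemma lift_orient_off x y z : ~~ ((a \in [set x; y; z]) && (c \in [set x; y; z])) ->
  lift_orient x y z = o2 (m x) (m y) (m z).
Proof.
move=> off; rewrite /lift_orient.
by do 6?[case: andP => [[/eqP E1 /eqP E2]|_];
  first by case/negP: off; rewrite !inE -?E1 -?E2 !eqxx ?orbT].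
Qed.

Lemma ac_face_cases x y z : [set x; y; z] \in T ->
  a \in [set x; y; z] -> c \in [set x; y; z] -> exists s,
  [/\ s != a, s != c, [set a; c; s] \in T &
   [\/ [\/ [/\ x = a, y = c & z = s], [/\ x = c, y = s & z = a] |
             [/\ x = s, y = a & z = c]] |
       [\/ [/\ x = c, y = a & z = s], [/\ x = a, y = s & z = c] |
             [/\ x = s, y = c & z = a]]]].
Proof.
move=> xyz; have [xy xz yz] := face_neq pT xyz.
rewrite !inE -!orbA => /or3P[]/eqP E1 /or3P[]/eqP E2.
- by case/eqP: nac; rewrite E1 E2.
- exists z; split; rewrite 1?eq_sym ?E1 ?E2 //.
  by left; constructor 1.
- exists y; split; rewrite ?E1 ?E2 //; first by rewrite eq_sym.
    by rewrite set3AC.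
  by right; constructor 2.
- exists z; split; rewrite 1?eq_sym ?E1 ?E2 //; first by rewrite set3C.
  by right; constructor 1.
- by case/eqP: nac; rewrite E1 E2.
- exists x; split; rewrite ?E1 ?E2 //; first by rewrite -set3_rot.
  by left; constructor 3.
- exists y; split; rewrite ?E1 ?E2 //; first by rewrite eq_sym.
    by rewrite set3_rot.
  by left; constructor 2.
- exists x; split; rewrite ?E1 ?E2 //; first by rewrite set3_rot set3C.
  by right; constructor 3.
- by case/eqP: nac; rewrite E1 E2.
Qed.

Lemma lift_orient_mixed x y z t : [set x; y; z] \in T -> [set x; y; t] \in T -> t != z ->
  a \in [set x; y; z] -> c \in [set x; y; z] -> lift_orient x y t = ~~ lift_orient x y z.
Proof.
move=> xyz xyt tz az cz.
have [s [sa sc acs H]] := ac_face_cases xyz az cz.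
have E := lift_orientE sa sc.
have [xy xt yt] := face_neq pT xyt.
have as_ : a != s by rewrite eq_sym.
have cs : c != s by rewrite eq_sym.
have off h k : [set h; s; t] \in T -> ends a c h k -> t != k ->
    ~~ ((a \in [set h; s; t]) && (c \in [set h; s; t])) /\ m h = a.
  move=> hst hk tk; rewrite (ends_merge fac hk); split=> //; rewrite !inE (negPf as_) (negPf cs) !orbF.
  case: hk tk => -[-> ->] tk; first by rewrite !(eq_sym c) (negPf nac) (negPf tk) andbF.
  by rewrite (negPf nac) (eq_sym a) (negPf tk).
have val_l : t != c -> [set a; s; t] \in T ->
    lift_orient a s t = side_orient s /\ lift_orient s a t = ~~ side_orient s.
  move=> tc ast; have hk : ends a c a c by left.
  have [nin _] := off _ _ ast hk tc; have [_ ta _] := face_neq pT ast.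
  have ast2 : [set a; s; t] \in T2.
    by apply: (face_contract_at nac (or_introl erefl)); rewrite // eq_sym.
  rewrite !lift_orient_off // 1?set3C // (merge_l nac) (merge_neq a sc) (merge_neq a tc).
  by rewrite (orient_swap12 oT2 ast2) (edge_orient_l acs ast tc).
have val_r : t != a -> [set c; s; t] \in T ->
    lift_orient c s t = ~~ side_orient s /\ lift_orient s c t = side_orient s.
  move=> ta cst; have hk : ends a c c a by right.
  have [nin _] := off _ _ cst hk ta; have [_ tc _] := face_neq pT cst.
  have tc' : t != c by rewrite eq_sym.
  have ast2 : [set a; s; t] \in T2.
    by apply: (face_contract_at nac (or_intror erefl)).
  rewrite !lift_orient_off // 1?set3C // merge_r (merge_neq a sc) (merge_neq a tc').
  by rewrite (orient_swap12 oT2 ast2) (edge_orient_r acs cst ta) negbK.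
case: H => -[] [xE yE zE]; rewrite xE yE zE in xyt tz *; rewrite E.
- have [_ at_ ct] := face_neq pT xyt; rewrite eq_sym in at_; rewrite eq_sym in ct.
  by rewrite (lift_orientE at_ ct) (side_orient_opp acs xyt tz).
- by case: (val_r tz xyt) => ->.
- by rewrite set3C in xyt; case: (val_l tz xyt).
- rewrite set3C in xyt.
  have [_ at_ ct] := face_neq pT xyt; rewrite eq_sym in at_; rewrite eq_sym in ct.
  by rewrite (lift_orientE at_ ct) (side_orient_opp acs xyt tz).
- by case: (val_l tz xyt); rewrite negbK.
- by rewrite set3C in xyt; case: (val_r tz xyt); rewrite negbK.
Qed.

Lemma lift_orientP : orientation T lift_orient.
Proof.
move=> x y z xyz.
have face x' y' z' : [set x'; y'; z'] \in T ->
   ~~ ((a \in [set x'; y'; z']) && (c \in [set x'; y'; z'])) ->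
   [set m x'; m y'; m z'] \in T2.
  by move=> H off; apply/contractP; exists [set x'; y'; z']; rewrite merge_set3.
split.
- case: (boolP ((a \in [set x; y; z]) && (c \in [set x; y; z]))) => [/andP[az cz]|off].
    have [s [sa sc _ H]] := ac_face_cases xyz az cz; have E := lift_orientE sa sc.
    by case: H => -[] [-> -> ->]; rewrite !E.
  have off' := off; rewrite (set3_rot x) in off'.
  by rewrite (lift_orient_off off) (lift_orient_off off') (orient_rot oT2 (face _ _ _ xyz off)).
- case: (boolP ((a \in [set x; y; z]) && (c \in [set x; y; z]))) => [/andP[az cz]|off].
    have [s [sa sc _ H]] := ac_face_cases xyz az cz; have E := lift_orientE sa sc.
    by case: H => -[] [-> -> ->]; rewrite !E ?negbK.
  have off' := off; rewrite (set3AC x) in off'.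
  by rewrite (lift_orient_off off) (lift_orient_off off') (orient_swap oT2 (face _ _ _ xyz off)).
move=> t tz xyt.
case: (boolP ((a \in [set x; y; z]) && (c \in [set x; y; z]))) => [/andP[az cz]|offz].
  exact: lift_orient_mixed.
case: (boolP ((a \in [set x; y; t]) && (c \in [set x; y; t]))) => [/andP[at_ ct]|offt].
  by rewrite [in RHS](lift_orient_mixed xyt) ?negbK // eq_sym.
rewrite !lift_orient_off //; apply: (orient_edge oT2 (face _ _ _ xyz offz) _ (face _ _ _ xyt offt)).
apply/eqP=> /(merge_inj nac)[E|[tE zE]|[tE zE]]; first by rewrite E eqxx in tz.
  rewrite tE -set3_rot in xyt; rewrite zE -set3_rot in xyz.
  by have := no_tetra xyt; rewrite xyz.
rewrite tE -set3_rot in xyt; rewrite zE -set3_rot in xyz.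
by have := no_tetra xyz; rewrite xyt.
Qed.

End Lift.

Lemma flat_contractible : contractible T a c.
Proof.
split; first exact: contract_tri.
split; first exact: contract_euler.
split; first exact: contract_orientable.
by case=> o2 oT2; exists (lift_orient o2); apply: lift_orientP.
Qed.

End FlatContraction.

Section Tetrahedron.
Variables (V : finType) (T : {set {set V}}) (a c x y : V).
Hypothesis TT : triangulation T.
Hypotheses (acx : [set a; c; x] \in T) (acy : [set a; c; y] \in T)
  (axy : [set a; x; y] \in T) (cxy : [set c; x; y] \in T).
Let pT : pure T := tri_face TT.
Let S := [set a; c; x; y].

Lemma tetra_uniq : uniq [:: a; c; x; y].
Proof.
have [ac ax cx] := face_neq pT acx; have [_ ay cy] := face_neq pT acy.
by have [_ _ xy] := face_neq pT axy; rewrite /= !inE !negb_or ac ax ay cx cy xy.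
Qed.

Lemma tetra_vertices : vertices T = S.
Proof.
have [ac ax cx] := face_adj pT acx; have [_ ay cy] := face_adj pT acy.
have [_ _ xy] := face_adj pT axy.
apply/eqP; rewrite eqEsubset; apply/andP; split; apply/subsetP=> v; last first.
  rewrite !inE -!orbA => /or4P[]/eqP->.
  - exact: adj_vertex ac.
  - exact: adj_vertex cx.
  - exact: adj_vertex xy.
  - by rewrite adj_sym in xy; apply: adj_vertex xy.
move=> vT; have step s t : s \in S -> adj T s t -> t \in S.
  have sub3 p q r : p \in S -> q \in S -> r \in S -> t \in [set p; q; r] -> t \in S.
    by move=> pS qS rS; rewrite 2!in_setU 3!in_set1 -orbA => /or3P[]/eqP->.
  have [aS cS xS yS] : [/\ a \in S, c \in S, x \in S & y \in S].
    by rewrite !inE !eqxx !orbT.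
  have cax : [set c; a; x] \in T by rewrite set3C.
  have cay : [set c; a; y] \in T by rewrite set3C.
  have xac : [set x; a; c] \in T by rewrite set3_rot.
  have xay : [set x; a; y] \in T by rewrite set3C.
  have xcy : [set x; c; y] \in T by rewrite set3C.
  have yac : [set y; a; c] \in T by rewrite set3_rot.
  have yax : [set y; a; x] \in T by rewrite set3_rot.
  have ycx : [set y; c; x] \in T by rewrite set3_rot.
  have S4 : s \in S -> [\/ s = a, s = c, s = x | s = y].
    by rewrite !inE -!orbA => /or4P[]/eqP->;
       [constructor 1|constructor 2|constructor 3|constructor 4].
  case/S4=> ->.
  - by move/(tri_deg3 TT acx acy axy); apply: sub3.
  - by move/(tri_deg3 TT cax cay cxy); apply: sub3.
  - by move/(tri_deg3 TT xac xay xcy); apply: sub3.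
  - by move/(tri_deg3 TT yac yax ycx); apply: sub3.
by apply: (connect_ind_pred step _ (tri_connected TT (adj_vertex ac) vT)); rewrite !inE eqxx.
Qed.

Lemma tetra_euler : euler_char T = (2%:Z)%R.
Proof.
have cS : #|S| = 4.
  rewrite -[4]/(size [:: a; c; x; y]) -(card_uniqP tetra_uniq); apply: eq_card => v.
  by rewrite !inE -!orbA.
have [ac ax cx] := face_adj pT acx; have [_ ay cy] := face_adj pT acy.
have [_ _ xy] := face_adj pT axy.
have E : edges T = [set e : {set V} | e \subset S & #|e| == 2].
  apply/setP=> e; rewrite [in RHS]inE; apply/idP/andP => [eT|[eS /cards2P[p [q [pq eE]]]]].
    split; last by move: eT; rewrite inE => /andP[].
    have [p [q [-> pq]]] := edgeP eT.
    rewrite subUset !sub1set -tetra_vertices (adj_vertex pq).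
    by rewrite adj_sym in pq; rewrite (adj_vertex pq).
  rewrite eE -/(adj T p q); move: eS pq; rewrite eE subUset !sub1set !inE -!orbA.
  case/andP=> /or4P[]/eqP-> /or4P[]/eqP->; rewrite ?eqxx // => _; rewrite // adj_sym //.
have := card_edges TT; rewrite /euler_char tetra_vertices E cards_draws cS.
by move=> H; have -> : #|T| = 4 by apply/eqP; rewrite -(eqn_pmul2l (isT : 0 < 3)) -H.
Qed.

Definition rank_parity i j k := (i < j) (+) (j < k) (+) (i < k) (+) odd (i + j + k).

Lemma rank_parity_edge i j k l : i < 4 -> j < 4 -> k < 4 -> l < 4 ->
  uniq [:: i; j; k; l] -> rank_parity i j l = ~~ rank_parity i j k.
Proof.
by case: i => [|[|[|[|i]]]] // _; case: j => [|[|[|[|j]]]] // _;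
   case: k => [|[|[|[|k]]]] // _; case: l => [|[|[|[|l]]]].
Qed.

Lemma tetra_orientable : orientable T.
Proof.
pose r v := index v [:: a; c; x; y].
have rS v : v \in vertices T -> v \in [:: a; c; x; y].
  by rewrite tetra_vertices !inE -!orbA.
exists (fun p q s => rank_parity (r p) (r q) (r s)) => p q s pqs.
have vert f v : f \in T -> v \in f -> v \in [:: a; c; x; y] /\ r v < 4.
  move=> fT vf; have vS := rS v (face_vertex fT vf); split=> //.
  by rewrite /r -[4]/(size [:: a; c; x; y]) index_mem.
have [|pS p4] := vert _ p pqs; rewrite ?inE ?eqxx ?orbT //.
have [|qS q4] := vert _ q pqs; rewrite ?inE ?eqxx ?orbT //.
have [|sS s4] := vert _ s pqs; rewrite ?inE ?eqxx ?orbT //.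
have rI v v' : v \in [:: a; c; x; y] -> v' \in [:: a; c; x; y] -> v != v' -> r v != r v'.
  by move=> vS v'S; apply: contraNneq => /(index_inj a vS v'S) ->.
have [pq ps qs] := face_neq pT pqs.
have rpq := rI _ _ pS qS pq; have rps := rI _ _ pS sS ps; have rqs := rI _ _ qS sS qs.
split.
- rewrite /rank_parity; move: rpq rps rqs; case: (ltngtP (r p) (r q)) => //;
  case: (ltngtP (r p) (r s)) => //; case: (ltngtP (r q) (r s)) => // *;
  by rewrite addnC addnA.
- rewrite /rank_parity addnAC; move: rpq rps rqs; case: (ltngtP (r p) (r q)) => //;
  case: (ltngtP (r p) (r s)) => //; case: (ltngtP (r q) (r s)) => // *;
  by case: odd.
move=> t ts pqt; have [|tS t4] := vert _ t pqt; rewrite ?inE ?eqxx ?orbT //.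
have [_ pt qt] := face_neq pT pqt.
apply: rank_parity_edge => //=; rewrite !inE !negb_or rpq rps rqs.
by rewrite (rI _ _ pS tS pt) (rI _ _ qS tS qt) (rI _ _ sS tS) // eq_sym.
Qed.

End Tetrahedron.

Lemma irreducible_nonflat (V : finType) (T : {set {set V}}) x y :
  triangulation T -> irreducible T -> ~ is_sphere T -> adj T x y -> ~~ flat T x y.
Proof.
move=> TT irr nS xy; apply/negP=> fxy.
have xyN s t : [set x; s; t] \in T -> [set y; s; t] \notin T.
  move=> xst; apply/negP=> yst; have pT := tri_face TT.
  have [xs xt _] := face_adj pT xst; have [ys yt _] := face_adj pT yst.
  have xys := flat_face fxy xs ys; have xyt := flat_face fxy xt yt.
  by apply: nS; split; [apply: tetra_orientable xyt xst yst|apply: tetra_euler xyt xst yst].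
exact: irr xy (flat_contractible TT fxy xyN).
Qed.

Lemma contracts_near (V : finType) (Fr : {set V}) (FrE : {set {set V}})
    (u v : 'I_3 -> V) (T T' : {set {set V}}) :
  (forall x y, [set x; y] \in FrE -> x \in Fr) ->
  (forall i, u i \in Fr) -> (forall i, v i \in Fr) -> (forall i, u i != v i) ->
  near_triangulation Fr T -> edges_on_paths FrE u v T -> vertices_on_paths Fr u v T ->
  contracts_avoiding Fr T T' ->
  edges_on_paths FrE u v T' /\ vertices_on_paths Fr u v T'.
Proof.
move=> FE uF vF uv nT eT vT TT'.
suff [] : [/\ near_triangulation Fr T', edges_on_paths FrE u v T' &
  vertices_on_paths Fr u v T'] by [].
elim: TT' => // T1 a c _ [nT1 eT1 vT1] ac aF cF [T2 _].
have fac := contract_flat nT1 aF cF ac T2.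
split; first exact: near_tri.
  exact: (edges_on_paths_contract nT1 aF cF fac FE uF vF uv eT1).
exact: (vertices_on_paths_contract nT1 aF cF fac uF vF uv vT1).
Qed.

Theorem theorem4p2 (V : finType) (T : {set {set V}}) (w : 'I_3 -> V)
    (side : 'I_3 -> {set V} -> bool) (T'' : {set {set cut_vertex V}}) :
  triangulation T -> irreducible T -> ~ is_sphere T ->
  three_cycle T w -> nonseparating T w -> cut_sides T w side ->
  triangulation T'' ->
  contracts_avoiding (frame_vertices T w) (pre_irreducible T w side) T'' ->
  (forall a c, adj T'' a c ->
     [\/ [set a; c] \in frame_edges T w,
         ~ contractible T'' a c |
         exists i p, short_path T'' (u' V i) (v' V i) p /\
                     edge_on_path a c (u' V i :: p)])
  /\
  (forall x, x \in vertices T'' ->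
     [\/ x \in frame_vertices T w,
         (exists y, adj T'' x y /\ ~ contractible T'' x y) |
         exists i j : 'I_3, i < j /\
           (exists p, short_path T'' (u' V i) (v' V i) p /\
                      x \in u' V i :: p) /\
           (exists p, short_path T'' (u' V j) (v' V j) p /\
                      x \in u' V j :: p)]).
Proof.
move=> TT irr nS wT _ cs TT'' contr.
have uv i : u' V i != v' V i by rewrite bnd_eq andbF.
have nonflat X Y : adj T X Y -> ~~ flat T X Y by apply: irreducible_nonflat.
have [eT'' vT''] := contracts_near (@frame_edge_Fr V T w) (bnd_Fr T w ^~ true)
  (bnd_Fr T w ^~ false) uv (pre_irreducible_near TT wT cs)
  (pre_irreducible_edges TT wT cs nonflat)
  (pre_irreducible_vertices TT wT cs nonflat) contr.
have contractible_flat a c : adj T'' a c -> ~~ flat T'' a c -> ~ contractible T'' a c.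
  move=> ac /negP nf [T2 _]; apply: nf.
  by apply: (contract_flat (near_tri set0 TT'')); rewrite ?inE.
split=> [a c ac|x xT].
  case: (boolP ([set a; c] \in frame_edges T w)) => acF; first by constructor 1.
  case: (boolP (flat T'' a c)) => [fac|nf]; last by constructor 2; apply: contractible_flat.
  have [i [p [q [path on]]]] := eT'' a c fac acF.
  have [s [sp edge _]] := lazy_path_short (uv i) path.
  by constructor 3; exists i, s; split=> //; apply: edge on; apply: adj_neq ac.
case: (boolP (x \in frame_vertices T w)) => xF; first by constructor 1.
case: (boolP [exists y, adj T'' x y && ~~ flat T'' x y]) => [/existsP[y /andP[xy nf]]|].
  by constructor 2; exists y; split=> //; apply: contractible_flat.
move=> /existsPn fx; constructor 3.
have [|i [j [ij oi oj]]] := vT'' x xT xF.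
  by move=> y xy; have := fx y; rewrite xy negbK.
have short k : on_path (u' V) (v' V) T'' k x ->
    exists p, short_path T'' (u' V k) (v' V k) p /\ x \in u' V k :: p.
  case=> p [q [path xpq]].
  have [s [sp _ vert]] := lazy_path_short (uv k) path.
  by exists s; split=> //; apply: vert.
case: (ltngtP i j) => [lt|lt|/val_inj E]; last by rewrite E eqxx in ij.
  by exists i, j; split=> //; split; apply: short.
by exists j, i; split=> //; split; apply: short.
Qed.
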